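(* Let $\mathcal{A}$ be a multiring category over $k$ with left duals, with unit object $1=\bigoplus_{i\in I}1_i$ and component subcategories $\mathcal{A}_{i,j}=1_i\otimes\mathcal{A}\otimes 1_j$ $(i,j\in I)$. Let $\mathcal{C}$ be a two-sided Serre tensor-ideal of $\mathcal{A}$ and put $J=\{i\in I\mid 1_i\in\mathcal{C}\}$. Then $\mathcal{C}=\bigoplus_{i,j\in J}\mathcal{A}_{i,j}$, and the restriction of the canonical functor $T:\mathcal{A}\to\mathcal{A}/\mathcal{C}$ to $\bigoplus_{i,j\notin J}\mathcal{A}_{i,j}$ is both an isomorphism and a monoidal functor; consequently the quotient category $\mathcal{A}/\mathcal{C}$ is isomorphic to $\bigoplus_{i,j\notin J}\mathcal{A}_{i,j}$, which is a subcategory of $\mathcal{A}$. Furthermore, $1_{\mathcal{A}/\mathcal{C}}=T(1_{\mathcal{A}})=\bigoplus_{i\notin J}1_i$, and for $i,j\notin J$, $\mathcal{A}_{i,j}$ is a component subcategory of $\mathcal{A}/\mathcal{C}$.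
   Context: $k$ is an algebraically closed field. A $k$-linear abelian category is locally finite if all its Hom spaces are finite dimensional over $k$ and every object has finite length. A multiring category over $k$ is a locally finite $k$-linear abelian monoidal category with bilinear and biexact tensor product. It has left duals if every object $X$ has a left dual $X^*$, i.e. there are morphisms $ev_X:X^*\otimes X\to 1$ and $coev_X:1\to X\otimes X^*$ such that the two usual compositions $X\to(X\otimes X^* )\otimes X\to X\otimes(X^*\otimes X)\to X$ and $X^*\to X^*\otimes(X\otimes X^* )\to(X^*\otimes X)\otimes X^*\to X^*$ are identities. In a multiring category with left duals the unit object $1=1_{\mathcal{A}}$ is semisimple and is a direct sum $1=\bigoplus_{i\in I}1_i$ of pairwise non-isomorphic simple objects $1_i$, where $1_i$ is the image of $p_i$ and $\{p_i\}_{i\in I}$ is the set of primitive idempotents of the algebra $\mathrm{End}(1)$. The component subcategories are $\mathcal{A}_{i,j}=1_i\otimes\mathcal{A}\otimes 1_j$, and $\mathcal{A}=\bigoplus_{i,j\in I}\mathcal{A}_{i,j}$. Here $i,j\notin J$ means $i,j\in I\setminus J$. A Serre subcategory of an abelian category $\mathcal{A}$ is a full additive subcategory closed under subobjects, quotients and extensions. A two-sided Serre tensor-ideal of $\mathcal{A}$ is a Serre subcategory $\mathcal{C}$ such that $X\otimes Y\in\mathcal{C}$ and $Y\otimes X\in\mathcal{C}$ for all $X\in\mathcal{A}$, $Y\in\mathcal{C}$. The quotient category $\mathcal{A}/\mathcal{C}$ has the same objects as $\mathcal{A}$, and $\mathrm{Hom}_{\mathcal{A}/\mathcal{C}}(M,N)=\varinjlim_{M',N'}\mathrm{Hom}_{\mathcal{A}}(M',N/N')$,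 where $M'\subset M$ and $N'\subset N$ run over the subobjects with $M/M'\in\mathcal{C}$ and $N'\in\mathcal{C}$; $T$ is the canonical functor. For $f:M'\to N/N'$ in this direct system, $Tf$ also denotes the morphism $M\to N$ of $\mathcal{A}/\mathcal{C}$ represented by $f$. Monoidal structure on $\mathcal{A}/\mathcal{C}$: the tensor product of objects is that of $\mathcal{A}$; for morphisms $\bar f=Tf:M\to N$, $\bar g=Tg:X\to Y$ represented by $f:M'\to N/N'$, $g:X'\to Y/Y'$, one sets $\bar f\otimes\bar g:=T(f\otimes g)$, the morphism $M\otimes X\to N\otimes Y$ represented by $f\otimes g:M'\otimes X'\to(N/N')\otimes(Y/Y')$, where $M'\otimes X'$ is regarded as a subobject of $M\otimes X$ and $(N/N')\otimes(Y/Y')$ as a quotient of $N\otimes Y$ (this is well defined); the associativity and unit isomorphisms are the images under $T$ of those of $\mathcal{A}$.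
   Formalization: ''Isomorphism'' and ''isomorphic'' for categories are read as k-linear equivalence (also for A_{i,j} as a component of A/C): A/C has all objects of A, so T restricted to the sum over i,j∉J is not bijective on objects once C has a nonzero object. *)

(* Defs.v *)
From HB Require Import structures.
From mathcomp Require Import all_boot all_algebra.
From mathcomp Require Import generic_quotient boolp.

Set Implicit Arguments.
Unset Strict Implicit.
Unset Printing Implicit Defensive.

Import GRing.Theory.
Local Open Scope ring_scope.
Local Open Scope quotient_scope.

Declare Scope cat_scope.
Delimit Scope cat_scope with cat.
Local Open Scope cat_scope.

Reserved Notation "g ∘ f" (at level 40, left associativity).
Reserved Notation "X ⊗ Y" (at level 38, left associativity).
Reserved Notation "f ⊠ g" (at level 38, left associativity).

Record linCat (K : fieldType) := LinCat {
  obj :> Type;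
  Mor : obj -> obj -> lmodType K;
  idm : forall X, Mor X X;
  hcomp : forall X Y Z, Mor Y Z -> Mor X Y -> Mor X Z;
  hcompA : forall X Y Z W (h : Mor Z W) (g : Mor Y Z) (f : Mor X Y),
    hcomp h (hcomp g f) = hcomp (hcomp h g) f;
  hcomp1m : forall X Y (f : Mor X Y), hcomp (idm Y) f = f;
  hcompm1 : forall X Y (f : Mor X Y), hcomp f (idm X) = f;
  hcomp_linl : forall X Y Z (a : K) (g g' : Mor Y Z) (f : Mor X Y),
    hcomp (a *: g + g') f = a *: hcomp g f + hcomp g' f;
  hcomp_linr : forall X Y Z (a : K) (g : Mor Y Z) (f f' : Mor X Y),
    hcomp g (a *: f + f') = a *: hcomp g f + hcomp g f'
}.
Arguments Mor {K l} _ _.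
Arguments idm {K l} _.
Notation "g ∘ f" := (hcomp g f) : cat_scope.

Section LinCatDefs.
Variables (K : fieldType) (A : linCat K).
Implicit Types X Y Z W : A.

Definition mono X Y (f : Mor X Y) : Prop :=
  forall W (g h : Mor W X), f ∘ g = f ∘ h -> g = h.

Definition epi X Y (f : Mor X Y) : Prop :=
  forall W (g h : Mor Y W), g ∘ f = h ∘ f -> g = h.

Definition is_iso X Y (f : Mor X Y) : Prop :=
  exists g : Mor Y X, g ∘ f = idm X /\ f ∘ g = idm Y.

Definition isomorphic X Y : Prop := exists f : Mor X Y, is_iso f.

Record iso X Y := Iso {
  ifwd :> Mor X Y;
  ibwd : Mor Y X;
  ifwdK : ibwd ∘ ifwd = idm X;
  ibwdK : ifwd ∘ ibwd = idm Y
}.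

Definition is_zero X : Prop := idm X = 0.

Definition is_kernel X Y (f : Mor X Y) N (k : Mor N X) : Prop :=
  f ∘ k = 0 /\
  forall W (g : Mor W X), f ∘ g = 0 -> exists! h : Mor W N, k ∘ h = g.

Definition is_cokernel X Y (f : Mor X Y) Q (c : Mor Y Q) : Prop :=
  c ∘ f = 0 /\
  forall W (g : Mor Y W), g ∘ f = 0 -> exists! h : Mor Q W, h ∘ c = g.

Definition is_biproduct (I : finType) (X : I -> A) (S : A)
    (inj : forall i, Mor (X i) S) (prj : forall i, Mor S (X i)) : Prop :=
  [/\ forall i, prj i ∘ inj i = idm (X i),
      forall i j, i != j -> prj j ∘ inj i = 0
    & \sum_i inj i ∘ prj i = idm S].

Definition short_exact X Y Z (i : Mor X Y) (p : Mor Y Z) : Prop :=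
  is_kernel p i /\ is_cokernel i p.

Record abelian_cat : Prop := Abelian {
  ab_biproduct : forall (I : finType) (X : I -> A),
    exists S (inj : forall i, Mor (X i) S) (prj : forall i, Mor S (X i)),
      is_biproduct inj prj;
  ab_kernel : forall X Y (f : Mor X Y), exists N (k : Mor N X), is_kernel f k;
  ab_cokernel : forall X Y (f : Mor X Y),
    exists Q (c : Mor Y Q), is_cokernel f c;
  ab_mono : forall X Y (f : Mor X Y), mono f ->
    exists Z (g : Mor Y Z), is_kernel g f;
  ab_epi : forall X Y (f : Mor X Y), epi f ->
    exists W (g : Mor W X), is_cokernel g f
}.

Definition simple_obj X : Prop :=
  ~ is_zero X /\
  forall Y (m : Mor Y X), mono m -> is_zero Y \/ is_iso m.

Inductive finite_length : A -> Prop :=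
| fl_zero X : is_zero X -> finite_length X
| fl_ext X Y S (i : Mor X Y) (p : Mor Y S) :
    short_exact i p -> simple_obj S -> finite_length X -> finite_length Y.

Definition hom_finite : Prop :=
  forall X Y, exists n (b : 'I_n -> Mor X Y),
    forall f, exists c : 'I_n -> K, f = \sum_i c i *: b i.

Definition locally_finite : Prop :=
  hom_finite /\ forall X, finite_length X.

Record serre := Serre {
  serre_mem :> A -> Prop;
  serre_sum : forall (I : finType) (X : I -> A) S
    (inj : forall i, Mor (X i) S) (prj : forall i, Mor S (X i)),
    is_biproduct inj prj -> (forall i, serre_mem (X i)) -> serre_mem S;
  serre_sub : forall X Y (m : Mor X Y), mono m -> serre_mem Y -> serre_mem X;
  serre_quo : forall X Y (q : Mor X Y), epi q -> serre_mem X -> serre_mem Y;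
  serre_ext : forall X Y Z (i : Mor X Y) (p : Mor Y Z), short_exact i p ->
    serre_mem X -> serre_mem Z -> serre_mem Y
}.

(** Given full subcategories [P i], the full subcategory [⊕_i P i]. *)
Definition sum_subcat (I : finType) (P : I -> A -> Prop) (S : A) : Prop :=
  exists (X : I -> A) (inj : forall i, Mor (X i) S)
    (prj : forall i, Mor S (X i)),
    (forall i, P i (X i)) /\ is_biproduct inj prj.

End LinCatDefs.

Definition op (K : fieldType) (A : linCat K) : linCat K.
Proof.
refine (@LinCat K A (fun X Y => Mor Y X) (@idm K A)
  (fun X Y Z g f => f ∘ g) _ _ _ _ _).
- by move=> *; rewrite hcompA.
- by move=> *; rewrite hcompm1.
- by move=> *; rewrite hcomp1m.
- by move=> *; rewrite hcomp_linr.
- by move=> *; rewrite hcomp_linl.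
Defined.

Section LinCatLemmas.
Variables (K : fieldType) (A : linCat K).
Implicit Types X Y Z W : A.

Lemma hcompDl X Y Z (g g' : Mor Y Z) (f : Mor X Y) :
  (g + g') ∘ f = g ∘ f + g' ∘ f.
Proof. by have := hcomp_linl 1 g g' f; rewrite !scale1r. Qed.

Lemma hcompDr X Y Z (g : Mor Y Z) (f f' : Mor X Y) :
  g ∘ (f + f') = g ∘ f + g ∘ f'.
Proof. by have := hcomp_linr 1 g f f'; rewrite !scale1r. Qed.

Lemma hcomp0m X Y Z (f : Mor X Y) : (0 : Mor Y Z) ∘ f = 0.
Proof. by apply: (@addrI _ (0 ∘ f)); rewrite -hcompDl !addr0. Qed.

Lemma hcompm0 X Y Z (g : Mor Y Z) : g ∘ (0 : Mor X Y) = 0.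
Proof. by apply: (@addrI _ (g ∘ 0)); rewrite -hcompDr !addr0. Qed.

Lemma hcompZl X Y Z (a : K) (g : Mor Y Z) (f : Mor X Y) :
  (a *: g) ∘ f = a *: (g ∘ f).
Proof. by have := hcomp_linl a g 0 f; rewrite hcomp0m !addr0. Qed.

Lemma hcompZr X Y Z (a : K) (g : Mor Y Z) (f : Mor X Y) :
  g ∘ (a *: f) = a *: (g ∘ f).
Proof. by have := hcomp_linr a g f 0; rewrite hcompm0 !addr0. Qed.

Lemma hcompNl X Y Z (g : Mor Y Z) (f : Mor X Y) : (- g) ∘ f = - (g ∘ f).
Proof. by rewrite -scaleN1r hcompZl scaleN1r. Qed.

Lemma hcompNr X Y Z (g : Mor Y Z) (f : Mor X Y) : g ∘ (- f) = - (g ∘ f).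
Proof. by rewrite -scaleN1r hcompZr scaleN1r. Qed.

Lemma hcompBl X Y Z (g g' : Mor Y Z) (f : Mor X Y) :
  (g - g') ∘ f = g ∘ f - g' ∘ f.
Proof. by rewrite hcompDl hcompNl. Qed.

Lemma hcompBr X Y Z (g : Mor Y Z) (f f' : Mor X Y) :
  g ∘ (f - f') = g ∘ f - g ∘ f'.
Proof. by rewrite hcompDr hcompNr. Qed.

Lemma monoP X Y (f : Mor X Y) :
  (forall W (g : Mor W X), f ∘ g = 0 -> g = 0) -> mono f.
Proof.
by move=> H W g h e; apply/subr0_eq/H; rewrite hcompBr e subrr.
Qed.

Lemma mono0 X Y (f : Mor X Y) W (g : Mor W X) : mono f -> f ∘ g = 0 -> g = 0.
Proof. by move=> H e; apply: H; rewrite e hcompm0. Qed.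

Lemma epiP X Y (f : Mor X Y) :
  (forall W (g : Mor Y W), g ∘ f = 0 -> g = 0) -> epi f.
Proof.
by move=> H W g h e; apply/subr0_eq/H; rewrite hcompBl e subrr.
Qed.

Lemma epi0 X Y (f : Mor X Y) W (g : Mor Y W) : epi f -> g ∘ f = 0 -> g = 0.
Proof. by move=> H e; apply: H; rewrite e hcomp0m. Qed.

Lemma mono_id X : mono (idm X).
Proof. by move=> W g h; rewrite !hcomp1m. Qed.

Lemma epi_id X : epi (idm X).
Proof. by move=> W g h; rewrite !hcompm1. Qed.

Lemma mono_comp X Y Z (g : Mor Y Z) (f : Mor X Y) :
  mono g -> mono f -> mono (g ∘ f).
Proof. by move=> Hg Hf W a b; rewrite -!hcompA => /Hg /Hf. Qed.

Lemma epi_comp X Y Z (g : Mor Y Z) (f : Mor X Y) :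
  epi g -> epi f -> epi (g ∘ f).
Proof. by move=> Hg Hf W a b; rewrite !hcompA => /Hf /Hg. Qed.

Lemma mono_fac X Y Z (g : Mor Y Z) (f : Mor X Y) : mono (g ∘ f) -> mono f.
Proof. by move=> H W a b e; apply: H; rewrite -!hcompA e. Qed.

Lemma epi_fac X Y Z (g : Mor Y Z) (f : Mor X Y) : epi (g ∘ f) -> epi g.
Proof. by move=> H W a b e; apply: H; rewrite !hcompA e. Qed.

Lemma kernel_mono X Y (f : Mor X Y) N (k : Mor N X) : is_kernel f k -> mono k.
Proof.
move=> [e H] W g h eq.
have [|x [_ u]] := H W (k ∘ g); first by rewrite hcompA e hcomp0m.
by rewrite -(u g) // -(u h).
Qed.

Lemma cokernel_epi X Y (f : Mor X Y) Q (c : Mor Y Q) :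
  is_cokernel f c -> epi c.
Proof.
move=> [e H] W g h eq.
have [|x [_ u]] := H W (g ∘ c); first by rewrite -hcompA e hcompm0.
by rewrite -(u g) // -(u h).
Qed.

Lemma kernel_fac X Y (f : Mor X Y) N (k : Mor N X) W (g : Mor W X) :
  is_kernel f k -> f ∘ g = 0 -> exists h, k ∘ h = g.
Proof. by move=> [_ H] /H [h [e _]]; exists h. Qed.

Lemma cokernel_fac X Y (f : Mor X Y) Q (c : Mor Y Q) W (g : Mor Y W) :
  is_cokernel f c -> g ∘ f = 0 -> exists h, h ∘ c = g.
Proof. by move=> [_ H] /H [h [e _]]; exists h. Qed.

Lemma kernelI X Y (f : Mor X Y) N (k : Mor N X) : mono k -> f ∘ k = 0 ->
  (forall W (g : Mor W X), f ∘ g = 0 -> exists h, k ∘ h = g) -> is_kernel f k.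
Proof.
move=> mk e H; split=> // W g /H [h eh]; exists h; split=> // h' eh'.
by apply: mk; rewrite eh.
Qed.

Lemma cokernelI X Y (f : Mor X Y) Q (c : Mor Y Q) : epi c -> c ∘ f = 0 ->
  (forall W (g : Mor Y W), g ∘ f = 0 -> exists h, h ∘ c = g) ->
  is_cokernel f c.
Proof.
move=> mk e H; split=> // W g /H [h eh]; exists h; split=> // h' eh'.
by apply: mk; rewrite eh.
Qed.

Lemma zero_hom X Y (f : Mor X Y) : is_zero X -> f = 0.
Proof. by move=> z; rewrite -(hcompm1 f) z hcompm0. Qed.

Lemma hom_zero X Y (f : Mor X Y) : is_zero Y -> f = 0.
Proof. by move=> z; rewrite -(hcomp1m f) z hcomp0m. Qed.

End LinCatLemmas.

Section Opposite.
Variables (K : fieldType) (A : linCat K).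

Lemma op_biproduct (I : finType) (X : I -> A) (S : A)
    (inj : forall i, Mor (X i) S) (prj : forall i, Mor S (X i)) :
  is_biproduct inj prj -> @is_biproduct K (op A) I X S prj inj.
Proof.
move=> [h1 h2 h3]; split=> // i j ij.
by apply: h2; rewrite eq_sym.
Qed.

Lemma op_abelian : abelian_cat A -> abelian_cat (op A).
Proof.
move=> [h1 h2 h3 h4 h5]; split.
- move=> I X; have [S [i [p h]]] := h1 I X.
  by exists S, p, i; apply: op_biproduct.
- by move=> X Y f; apply: (h3 Y X f).
- by move=> X Y f; apply: (h2 Y X f).
- by move=> X Y f; apply: (h5 Y X f).
- by move=> X Y f; apply: (h4 Y X f).
Qed.

Definition op_serre (C : serre A) : serre (op A).
Proof.
refine (@Serre K (op A) C _ _ _ _).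
- move=> I X S i p [h1 h2 h3]; apply: (@serre_sum _ _ C I X S p i).
  by split=> // a b ab; apply: h2; rewrite eq_sym.
- by move=> X Y m hm; apply: (@serre_quo _ _ C Y X m).
- by move=> X Y m hm; apply: (@serre_sub _ _ C Y X m).
- move=> X Y Z i p [h1 h2] hX hZ.
  exact: (@serre_ext _ _ C Z Y X p i (conj h2 h1)).
Defined.

End Opposite.

Section AbelianLemmas.
Variables (K : fieldType) (A : linCat K) (hA : abelian_cat A).
Implicit Types X Y Z W : A.

Lemma mono_epi_iso X Y (f : Mor X Y) : mono f -> epi f -> is_iso f.
Proof.
move=> mf ef; have [Z [g kf]] := ab_mono hA mf.
have g0 : g = 0 by apply: (epi0 ef _); case: kf.
have [h eh] : exists h, f ∘ h = idm Y.
  by apply: (kernel_fac kf _); rewrite g0 hcomp0m.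
by exists h; split=> //; apply: mf; rewrite hcompA eh hcomp1m hcompm1.
Qed.

Lemma mono_kernel X Y (f : Mor X Y) Q (c : Mor Y Q) :
  mono f -> is_cokernel f c -> is_kernel c f.
Proof.
move=> mf hc; have [Z [g kf]] := ab_mono hA mf.
apply: kernelI => //; first by case: hc.
move=> W a ca; apply: (kernel_fac kf _).
have [d <-] : exists d, d ∘ c = g by apply: (cokernel_fac hc _); case: kf.
by rewrite -hcompA ca hcompm0.
Qed.

Lemma epi_cokernel X Y (f : Mor X Y) N (k : Mor N X) :
  epi f -> is_kernel f k -> is_cokernel k f.
Proof.
move=> ef hk; have [Z [g cf]] := ab_epi hA ef.
apply: cokernelI => //; first by case: hk.
move=> W a ca; apply: (cokernel_fac cf _).
have [d <-] : exists d, k ∘ d = g by apply: (kernel_fac hk _); case: cf.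
by rewrite hcompA ca hcomp0m.
Qed.

Lemma image_ex X Y (f : Mor X Y) :
  exists I (e : Mor X I) (m : Mor I Y), [/\ epi e, mono m & f = m ∘ e].
Proof.
have [Q [c hc]] := ab_cokernel hA f; have [I [m hm]] := ab_kernel hA c.
have mm := kernel_mono hm.
have [e fe] : exists e, m ∘ e = f by apply: (kernel_fac hm _); case: hc.
exists I, e, m; split=> //; apply: epiP => W g ge.
have [N [k hk]] := ab_kernel hA g; have mk := kernel_mono hk.
have [e' ee'] : exists e', k ∘ e' = e by apply: kernel_fac hk ge.
have [Q' [c' hc']] := ab_cokernel hA (m ∘ k).
have hmk := mono_kernel (mono_comp mm mk) hc'.
have [d dc] : exists d, d ∘ c = c'.
  apply: (cokernel_fac hc _).
  by rewrite -fe -ee' hcompA hcompA -(hcompA c') (proj1 hc') hcomp0m.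
have [l el] : exists l, m ∘ k ∘ l = m.
  by apply: (kernel_fac hmk _); rewrite -dc -hcompA (proj1 hm) hcompm0.
have kl : k ∘ l = idm I by apply: mm; rewrite hcompA el hcompm1.
by rewrite -(hcompm1 g) -kl hcompA (proj1 hk) hcomp0m.
Qed.

Definition is_pullback X Y Z (f : Mor X Z) (g : Mor Y Z)
    P (p1 : Mor P X) (p2 : Mor P Y) : Prop :=
  f ∘ p1 = g ∘ p2 /\
  forall W (a : Mor W X) (b : Mor W Y), f ∘ a = g ∘ b ->
    exists! r : Mor W P, p1 ∘ r = a /\ p2 ∘ r = b.

Lemma pullback_full X Y Z (f : Mor X Z) (g : Mor Y Z) :
  exists P (p1 : Mor P X) (p2 : Mor P Y), is_pullback f g p1 p2 /\
    (epi f -> epi p2).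
Proof.
pose F (b : bool) : A := if b then X else Y.
have [S [i [p [h1 h2 h3]]]] := ab_biproduct hA F.
pose i1 : Mor X S := i true; pose i2 : Mor Y S := i false.
pose q1 : Mor S X := p true; pose q2 : Mor S Y := p false.
have q1i1 : q1 ∘ i1 = idm X := h1 true.
have q2i2 : q2 ∘ i2 = idm Y := h1 false.
have q2i1 : q2 ∘ i1 = 0 := h2 true false erefl.
have q1i2 : q1 ∘ i2 = 0 := h2 false true erefl.
have sumS : i1 ∘ q1 + i2 ∘ q2 = idm S by rewrite -h3 big_bool.
pose d := f ∘ q1 - g ∘ q2.
have [P [k hk]] := ab_kernel hA d; have mk := kernel_mono hk.
exists P, (q1 ∘ k), (q2 ∘ k); split.
  split.
    by apply/subr0_eq; rewrite !hcompA -hcompBl (proj1 hk).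
  move=> W a b eab.
  have [r er] : exists r, k ∘ r = i1 ∘ a + i2 ∘ b.
    apply: (kernel_fac hk _).
    rewrite hcompBl !hcompDr -!hcompA !(hcompA q1) !(hcompA q2).
    by rewrite q1i1 q1i2 q2i1 q2i2 !hcomp0m !hcomp1m !hcompm0 addr0 add0r eab subrr.
  exists r; split.
    rewrite -!hcompA er !hcompDr !hcompA q1i1 q1i2 q2i1 q2i2.
    by rewrite !hcomp0m !hcomp1m addr0 add0r.
  move=> r' [e1 e2]; apply: mk; rewrite er -e1 -e2.
  by rewrite -[RHS]hcomp1m -sumS hcompDl !hcompA.
move=> ef.
have di1 : d ∘ i1 = f.
  by rewrite hcompBl -!hcompA q1i1 q2i1 hcompm0 subr0 hcompm1.
have ed : epi d by apply: (@epi_fac _ _ _ _ _ d i1); rewrite di1.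
have cd := epi_cokernel ed hk.
apply: epiP => W h hp.
have [w ew] : exists w, w ∘ d = h ∘ q2.
  by apply: (cokernel_fac cd _); rewrite -hcompA.
have w0 : w = 0.
  by apply: (epi0 ef _); rewrite -di1 hcompA ew -hcompA q2i1 hcompm0.
by rewrite -(hcompm1 h) -q2i2 hcompA -ew w0 !hcomp0m.
Qed.

Lemma pullback_ex X Y Z (f : Mor X Z) (g : Mor Y Z) :
  exists P (p1 : Mor P X) (p2 : Mor P Y), is_pullback f g p1 p2.
Proof. by have [P [p [q [h _]]]] := pullback_full f g; exists P, p, q. Qed.

Lemma epi_cover X Y Z (f : Mor X Z) (g : Mor Y Z) : epi f ->
  exists P (p : Mor P X) (e : Mor P Y), epi e /\ f ∘ p = g ∘ e.
Proof.
move=> ef; have [P [p [q [[h _] e]]]] := pullback_full f g.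
by exists P, p, q; split=> //; apply: e.
Qed.

Lemma pullback_joint X Y Z (f : Mor X Z) (g : Mor Y Z) P (p1 : Mor P X)
    (p2 : Mor P Y) W (r : Mor W P) : is_pullback f g p1 p2 ->
  p1 ∘ r = 0 -> p2 ∘ r = 0 -> r = 0.
Proof.
move=> [_ H] e1 e2; have [|s [_ u]] := H W 0 0; first by rewrite !hcompm0.
by rewrite -(u r) // -(u 0) // !hcompm0.
Qed.

Lemma pullback_fac X Y Z (f : Mor X Z) (g : Mor Y Z) P (p1 : Mor P X)
    (p2 : Mor P Y) W (a : Mor W X) (b : Mor W Y) : is_pullback f g p1 p2 ->
  f ∘ a = g ∘ b -> exists r, p1 ∘ r = a /\ p2 ∘ r = b.
Proof. by move=> [_ H] /H [r [e _]]; exists r. Qed.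

(** [f] factors through [im g] when it is killed by [coker g]. *)
Lemma coker_cover X Y Q (g : Mor X Y) (c : Mor Y Q) W (f : Mor W Y) :
  is_cokernel g c -> c ∘ f = 0 ->
  exists V (v : Mor V W) (n : Mor V X), epi v /\ g ∘ n = f ∘ v.
Proof.
move=> hc cf; have [I [e [m [ee mm eg]]]] := image_ex g.
have hc' : is_cokernel m c.
  apply: cokernelI; first exact: cokernel_epi hc.
    by apply: (epi0 ee _); rewrite -hcompA -eg; case: hc.
  by move=> U h hm; apply: (cokernel_fac hc _); rewrite eg hcompA hm hcomp0m.
have [l el] := kernel_fac (mono_kernel mm hc') cf.
have [V [n [v [ev hv]]]] := epi_cover l ee.
by exists V, v, n; split=> //; rewrite eg -hcompA hv hcompA el.
Qed.

End AbelianLemmas.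

Section Negligible.
Variables (K : fieldType) (A : linCat K) (hA : abelian_cat A) (C : serre A).
Implicit Types X Y Z W : A.

(** [M' ⊂ M] with [M/M' ∈ C]. *)
Definition cosmall_mono X Y (m : Mor X Y) : Prop :=
  mono m /\ exists Q (c : Mor Y Q), is_cokernel m c /\ C Q.

(** [N → N/N'] with [N' ∈ C]. *)
Definition small_epi X Y (q : Mor X Y) : Prop :=
  epi q /\ exists N (k : Mor N X), is_kernel q k /\ C N.

(** [smallK f] and [smallC f] say that the kernel, resp. the cokernel of [f]
    belongs to [C]. *)
Definition smallK X Y (f : Mor X Y) : Prop :=
  forall W (w : Mor W X), mono w -> f ∘ w = 0 -> C W.

Definition smallC X Y (f : Mor X Y) : Prop :=
  forall W (h : Mor Y W), epi h -> h ∘ f = 0 -> C W.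

Definition Ciso X Y (f : Mor X Y) : Prop := smallK f /\ smallC f.

Lemma serre_zero Z : is_zero Z -> C Z.
Proof.
move=> z; apply: (@serre_sum _ _ C 'I_0 (fun=> Z) Z (fun=> 0) (fun=> 0)).
  by split=> [[]|[]|] //; rewrite big_ord0 z.
by case.
Qed.

Lemma mono_smallK X Y (f : Mor X Y) : mono f -> smallK f.
Proof.
move=> mf W w mw e; apply: serre_zero.
by apply: mw; rewrite hcompm0 hcompm1; apply: mono0 e.
Qed.

Lemma epi_smallC X Y (f : Mor X Y) : epi f -> smallC f.
Proof.
move=> mf W w mw e; apply: serre_zero.
by apply: mw; rewrite hcomp0m hcomp1m; apply: epi0 e.
Qed.

Lemma cosmall_Ciso X Y (m : Mor X Y) : cosmall_mono m -> Ciso m.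
Proof.
move=> [mm [Q [c [hc CQ]]]]; split; first exact: mono_smallK.
move=> W h eh hm; have [d ed] := cokernel_fac hc hm.
by apply: serre_quo (d) _ CQ; apply: (@epi_fac _ _ _ _ _ d c); rewrite ed.
Qed.

Lemma small_Ciso X Y (q : Mor X Y) : small_epi q -> Ciso q.
Proof.
move=> [mm [N [k [hk CN]]]]; split; last exact: epi_smallC.
move=> W h eh hm; have [d ed] := kernel_fac hk hm.
by apply: serre_sub (d) _ CN; apply: (@mono_fac _ _ _ _ _ k d); rewrite ed.
Qed.

Lemma Ciso_cosmall X Y (m : Mor X Y) : mono m -> smallC m -> cosmall_mono m.
Proof.
move=> mm cm; split=> //; have [Q [c hc]] := ab_cokernel hA m.
by exists Q, c; split=> //; apply: (cm _ _ (cokernel_epi hc) _); case: hc.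
Qed.

Lemma Ciso_small X Y (q : Mor X Y) : epi q -> smallK q -> small_epi q.
Proof.
move=> mm cm; split=> //; have [Q [c hc]] := ab_kernel hA q.
by exists Q, c; split=> //; apply: (cm _ _ (kernel_mono hc) _); case: hc.
Qed.

Lemma smallK_fac X Y Z (g : Mor Y Z) (f : Mor X Y) : smallK (g ∘ f) -> smallK f.
Proof. by move=> H W w mw e; apply: (H _ _ mw); rewrite -hcompA e hcompm0. Qed.

Lemma smallC_fac X Y Z (g : Mor Y Z) (f : Mor X Y) : smallC (g ∘ f) -> smallC g.
Proof. by move=> H W w mw e; apply: (H _ _ mw); rewrite hcompA e hcomp0m. Qed.

Lemma smallK_comp X Y Z (g : Mor Y Z) (f : Mor X Y) :
  smallK g -> smallK f -> smallK (g ∘ f).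
Proof.
move=> Hg Hf W w mw e0; have [I [e [m [ee mm fw]]]] := image_ex hA (f ∘ w).
have CI : C I.
  apply: (Hg _ _ mm); apply: (epi0 ee).
  by rewrite -hcompA -fw hcompA.
have [N [k hk]] := ab_kernel hA e.
have CN : C N.
  apply: (Hf _ _ (mono_comp mw (kernel_mono hk)) _).
  by rewrite hcompA fw -hcompA (proj1 hk) hcompm0.
apply: (serre_ext (i := k) (p := e)) CN CI; split=> //.
exact: epi_cokernel.
Qed.

Lemma smallK_epi X Y Z (b : Mor Y Z) (q : Mor X Y) :
  epi q -> smallK (b ∘ q) -> smallK b.
Proof.
move=> eq Kbq W z mz bz; have [V [p [r [er hr]]]] := epi_cover hA z eq.
have [I [d [j [ed mj ep]]]] := image_ex hA p.
have CI : C I.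
  apply: (Kbq _ _ mj); apply: (epi0 ed).
  by rewrite -!hcompA -ep hr hcompA bz hcomp0m.
have [L [k hk]] := ab_kernel hA d.
have [g eg] : exists g, g ∘ d = r.
  apply: (cokernel_fac (epi_cokernel hA ed hk)).
  by apply: (mono0 mz); rewrite hcompA -hr ep -!hcompA (proj1 hk) !hcompm0.
by apply: serre_quo (g) _ CI; apply: (@epi_fac _ _ _ _ _ g d); rewrite eg.
Qed.

Lemma Ciso_pullback X Y Z (f : Mor X Z) (g : Mor Y Z)
    P (p1 : Mor P X) (p2 : Mor P Y) :
  is_pullback f g p1 p2 -> Ciso f -> Ciso p2.
Proof.
move=> pb [Kf Cf]; split.
  move=> W w mw e; apply: (Kf W (p1 ∘ w)); last first.
    by rewrite hcompA (proj1 pb) -hcompA e hcompm0.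
  apply: monoP => V a; rewrite -hcompA => ea.
  apply: (mono0 mw); apply: (pullback_joint pb ea).
  by rewrite hcompA e hcomp0m.
move=> W h eh hp2; have [Q [c hc]] := ab_cokernel hA f.
have CQ : C Q by apply: (Cf _ _ (cokernel_epi hc)); case: hc.
have [E [e [m [ee mm ecg]]]] := image_ex hA (c ∘ g).
have CE : C E := serre_sub mm CQ.
have [N [k hk]] := ab_kernel hA e.
have [V [v [n [ev fn]]]] : exists V (v : Mor V N) (n : Mor V X),
    epi v /\ f ∘ n = g ∘ k ∘ v.
  apply: (coker_cover hA hc).
  by rewrite hcompA ecg -hcompA (proj1 hk) hcompm0.
have [r [_ er]] : exists r, p1 ∘ r = n /\ p2 ∘ r = k ∘ v.
  by apply: (pullback_fac pb _); rewrite fn hcompA.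
have hk0 : h ∘ k = 0.
  by apply: (epi0 ev _); rewrite -hcompA -er hcompA hp2 hcomp0m.
have [h' eh'] := cokernel_fac (epi_cokernel hA ee hk) hk0.
by apply: serre_quo (h') _ CE; apply: (@epi_fac _ _ _ _ _ h' e); rewrite eh'.
Qed.

End Negligible.

Section CalculusOfFractions.
Variables (K : fieldType) (A : linCat K) (hA : abelian_cat A) (C : serre A).
Implicit Types X Y Z W : A.
Local Notation Ciso := (Ciso C).

Lemma smallC_comp X Y Z (g : Mor Y Z) (f : Mor X Y) :
  smallC C g -> smallC C f -> smallC C (g ∘ f).
Proof.
by move=> Hg Hf; apply: (@smallK_comp K (op A) (op_abelian hA) (op_serre C) Z Y X f g).
Qed.

Lemma Ciso_comp X Y Z (g : Mor Y Z) (f : Mor X Y) :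
  Ciso g -> Ciso f -> Ciso (g ∘ f).
Proof.
move=> [a b] [c d].
by split; [exact: (smallK_comp hA a c) | exact: (smallC_comp b d)].
Qed.

Lemma Ciso_id X : Ciso (idm X).
Proof.
by split; [apply/mono_smallK/mono_id | apply/epi_smallC/epi_id].
Qed.

Definition is_pushout X Y Z (f : Mor Z X) (g : Mor Z Y)
    P (p1 : Mor X P) (p2 : Mor Y P) : Prop :=
  @is_pullback K (op A) X Y Z f g P p1 p2.

Lemma pushout_ex X Y Z (f : Mor Z X) (g : Mor Z Y) :
  exists P (p1 : Mor X P) (p2 : Mor Y P), is_pushout f g p1 p2.
Proof. exact: (@pullback_ex K (op A) (op_abelian hA) X Y Z f g). Qed.

Lemma Ciso_pushout X Y Z (f : Mor Z X) (g : Mor Z Y)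
    P (p1 : Mor X P) (p2 : Mor Y P) :
  is_pushout f g p1 p2 -> Ciso f -> Ciso p2.
Proof.
move=> po [Kf Cf].
by have [] := @Ciso_pullback K (op A) (op_abelian hA) (op_serre C) X Y Z f g P p1 p2 po (conj Cf Kf).
Qed.

Lemma ore_pullback X Y Z (f : Mor Y Z) (s : Mor X Z) : Ciso s ->
  exists P (v : Mor P Y) (w : Mor P X), is_pullback s f w v /\ Ciso v.
Proof.
move=> Cs; have [P [p1 [p2 pb]]] := pullback_ex hA s f.
by exists P, p2, p1; split=> //; apply: (Ciso_pullback hA pb Cs).
Qed.

Lemma ore X Y Z (s : Mor X Z) (s' : Mor Y Z) : Ciso s -> Ciso s' ->
  exists P (w : Mor P X) (w' : Mor P Y), s ∘ w = s' ∘ w' /\ Ciso (s ∘ w).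
Proof.
move=> Cs Cs'; have [P [v [w [pb Cv]]]] := ore_pullback s' Cs.
exists P, w, v; rewrite (proj1 pb); split=> //.
exact: Ciso_comp.
Qed.

Lemma ore_cancel X Y Z (q : Mor Y Z) (t t' : Mor X Y) : smallK C q ->
  q ∘ t = q ∘ t' -> exists P (k : Mor P X), Ciso k /\ t ∘ k = t' ∘ k.
Proof.
move=> Kq eqt; pose g := t - t'.
have qg : q ∘ g = 0 by rewrite hcompBr eqt subrr.
have [P [k hk]] := ab_kernel hA g; exists P, k; split; last first.
  by apply/subr0_eq; rewrite -hcompBl (proj1 hk).
split; first exact/mono_smallK/(kernel_mono hk).
move=> V h eh hk0; have [I [e [m [ee mm eg]]]] := image_ex hA g.
have CI : C I.
  by apply: (Kq _ _ mm); apply: (epi0 ee); rewrite -hcompA -eg.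
have hk' : is_kernel e k.
  apply: kernelI; first exact: kernel_mono hk.
    by apply: (mono0 mm); rewrite hcompA -eg; case: hk.
  by move=> W a ea; apply: (kernel_fac hk); rewrite eg -hcompA ea hcompm0.
have [h' eh'] := cokernel_fac (epi_cokernel hA ee hk') hk0.
by apply: serre_quo (h') _ CI; apply: (@epi_fac _ _ _ _ _ h' e); rewrite eh'.
Qed.

Lemma pushoutE X Y Z (f : Mor Z X) (g : Mor Z Y)
    P (p1 : Mor X P) (p2 : Mor Y P) :
  is_pushout f g p1 p2 -> p1 ∘ f = p2 ∘ g.
Proof. by case. Qed.

Lemma pushout_joint X Y Z (f : Mor Z X) (g : Mor Z Y)
    P (p1 : Mor X P) (p2 : Mor Y P) W (r : Mor P W) :
  is_pushout f g p1 p2 -> r ∘ p1 = 0 -> r ∘ p2 = 0 -> r = 0.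
Proof. exact: (@pullback_joint K (op A) X Y Z f g P p1 p2 W r). Qed.

Lemma pushout_epi X Y Z (f : Mor Z X) (g : Mor Z Y)
    P (p1 : Mor X P) (p2 : Mor Y P) : is_pushout f g p1 p2 -> epi f -> epi p2.
Proof.
move=> po ef; apply: epiP => W r r2; apply: (pushout_joint po) => //.
by apply: (epi0 ef); rewrite -hcompA (pushoutE po) hcompA r2 hcomp0m.
Qed.

End CalculusOfFractions.

Section Quotient.
Variables (K : fieldType) (A : linCat K) (hA : abelian_cat A) (C : serre A).
Local Notation Ciso := (Ciso C).

(** A morphism [f : M' → N/N'] of the direct system defining
    [Hom_{A/C}(M, N)]; [M'] is given by a monomorphism into [M], and [N/N']
    by an epimorphism from [N]. *)
Record frac (M N : A) := Frac {
  fsub : A;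
  fquo : A;
  fmono : Mor fsub M;
  fepi : Mor N fquo;
  fmor : Mor fsub fquo;
  fmonoP : cosmall_mono C fmono;
  fepiP : small_epi C fepi
}.

(** Two such morphisms have the same class in the direct limit when they agree
    on a smaller [M'] and a larger [N']. *)
Definition frac_eq M N (x y : frac M N) : Prop :=
  exists (S Q : A) (a : Mor S (fsub x)) (a' : Mor S (fsub y))
    (b : Mor (fquo x) Q) (b' : Mor (fquo y) Q),
    [/\ fmono x ∘ a = fmono y ∘ a', cosmall_mono C (fmono x ∘ a),
        b ∘ fepi x = b' ∘ fepi y, small_epi C (b ∘ fepi x)
      & b ∘ fmor x ∘ a = b' ∘ fmor y ∘ a'].

Definition frac_with M N (x : frac M N) (g : Mor (fsub x) (fquo x)) :
  frac M N := Frac g (fmonoP x) (fepiP x).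

(** [Tx = (Tt)(Ts)^-1] *)
Definition compat M N (x : frac M N) Q (s : Mor Q M) (t : Mor Q N) : Prop :=
  Ciso s /\ exists u, fmono x ∘ u = s /\ fepi x ∘ t = fmor x ∘ u.

Lemma compat_ex M N (x : frac M N) :
  exists Q (s : Mor Q M) (t : Mor Q N), compat x s t.
Proof.
have [Q [v [w [pb Cv]]]] :=
  ore_pullback hA (fmor x) (small_Ciso (fepiP x)).
exists Q, (fmono x ∘ v), w; split; last by exists v; case: pb.
exact: Ciso_comp (cosmall_Ciso (fmonoP x)) Cv.
Qed.

Lemma compat_refine M N (x : frac M N) Q (s : Mor Q M) (t : Mor Q N)
    P (w : Mor P Q) : compat x s t -> Ciso (s ∘ w) -> compat x (s ∘ w) (t ∘ w).
Proof.
move=> [_ [u [e1 e2]]] Cw; split=> //; exists (u ∘ w).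
by rewrite !hcompA e1 e2.
Qed.

Lemma compat_common M N (x : frac M N) Q (s : Mor Q M) (t : Mor Q N)
    Q' (s' : Mor Q' M) (t' : Mor Q' N) : compat x s t -> compat x s' t' ->
  exists P (w : Mor P Q) (w' : Mor P Q'),
    [/\ Ciso (s ∘ w), s ∘ w = s' ∘ w' & t ∘ w = t' ∘ w'].
Proof.
move=> [Cs [u [e1 e2]]] [Cs' [u' [e1' e2']]].
have [P [w [w' [e Cw]]]] := ore hA Cs Cs'.
have euw : u ∘ w = u' ∘ w'.
  by apply: (proj1 (fmonoP x)); rewrite !hcompA e1 e1'.
have [|R [k [Ck ek]]] :=
    @ore_cancel _ _ hA C _ _ _ (fepi x) (t ∘ w) (t' ∘ w')
      (proj1 (small_Ciso (fepiP x))).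
  by rewrite !hcompA e2 e2' -!hcompA euw.
exists R, (w ∘ k), (w' ∘ k); rewrite !hcompA e; split=> //.
by rewrite -e; apply: Ciso_comp.
Qed.

Lemma compat_frac_eq M N (x y : frac M N) Q (s : Mor Q M) (t : Mor Q N) :
  compat x s t -> compat y s t -> frac_eq x y.
Proof.
move=> [Cs [u [e1 e2]]] [_ [u' [e1' e2']]].
have [S [e [i [ee mi es]]]] := image_ex hA s.
have fac (z : frac M N) v : fmono z ∘ v = s ->
    exists a, fmono z ∘ a = i /\ a ∘ e = v.
  move=> ez; have mz := proj1 (fmonoP z).
  have [R [c hc]] := ab_cokernel hA (fmono z).
  have [a ea] : exists a, fmono z ∘ a = i.
    apply: (kernel_fac (mono_kernel hA mz hc)); apply: (epi0 ee).
    by rewrite -hcompA -es -ez hcompA (proj1 hc) hcomp0m.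
  by exists a; split=> //; apply: mz; rewrite hcompA ea -es ez.
have [a [ea1 ea2]] := fac x u e1; have [a' [ea1' ea2']] := fac y u' e1'.
have [R [b [b' po]]] := pushout_ex hA (fepi x) (fepi y).
exists S, R, a, a', b, b'; have epo := pushoutE po.
split; rewrite ?ea1 ?ea1' //.
- apply: Ciso_cosmall => //; apply: smallC_fac (e) _.
  by rewrite -es; case: Cs.
- rewrite epo; apply: Ciso_small => //.
    apply: epi_comp; last exact: (proj1 (fepiP y)).
    exact: pushout_epi po (proj1 (fepiP x)).
  apply: (proj1 (Ciso_comp hA _ (small_Ciso (fepiP y)))).
  exact: Ciso_pushout po (small_Ciso (fepiP x)).
apply: ee; rewrite -!hcompA ea2 ea2' -e2 -e2' hcompA epo -hcompA //.
Qed.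

Lemma frac_eq_compat M N (x y : frac M N) : frac_eq x y ->
  exists Q (s : Mor Q M) (t : Mor Q N), compat x s t /\ compat y s t.
Proof.
move=> [S [R [a [a' [b [b' [e1 c1 e2 c2 e3]]]]]]].
have [Q [v [w [pb Cv]]]] :=
  ore_pullback hA (b ∘ fmor x ∘ a) (small_Ciso c2).
have ew := proj1 pb.
have Kb : smallK C b.
  exact: (smallK_epi hA (proj1 (fepiP x)) (proj1 (small_Ciso c2))).
have Kb' : smallK C b'.
  apply: (smallK_epi hA (proj1 (fepiP y))).
  by rewrite -e2; exact: (proj1 (small_Ciso c2)).
have [|P1 [k1 [Ck1 ek1]]] :=
    @ore_cancel _ _ hA C _ _ _ b (fepi x ∘ w) (fmor x ∘ a ∘ v) Kb.
  by rewrite !hcompA ew.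
have [|P2 [k2 [Ck2 ek2]]] := @ore_cancel _ _ hA C _ _ _ b'
    (fepi y ∘ w ∘ k1) (fmor y ∘ a' ∘ v ∘ k1) Kb'.
  by rewrite !hcompA -e2 ew e3.
have Cs : Ciso (fmono x ∘ a ∘ v ∘ k1 ∘ k2).
  do 3 (apply: Ciso_comp => //).
  exact: cosmall_Ciso.
exists P2, (fmono x ∘ a ∘ v ∘ k1 ∘ k2), (w ∘ k1 ∘ k2); split; split=> //.
  by exists (a ∘ v ∘ k1 ∘ k2); rewrite !hcompA ek1.
by exists (a' ∘ v ∘ k1 ∘ k2); rewrite !hcompA e1 ek2.
Qed.

Lemma frac_of_spans M N Q (s : Mor Q M) (t t' : Mor Q N) : Ciso s ->
  exists (x : frac M N) g, compat x s t /\ compat (frac_with (x := x) g) s t'.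
Proof.
move=> Cs; have [S [e [i [ee mi es]]]] := image_ex hA s.
have Ci : cosmall_mono C i.
  by apply: (Ciso_cosmall hA mi); apply: smallC_fac (e) _; rewrite -es; case: Cs.
have Ce : Ciso e.
  split; last exact: epi_smallC.
  by apply: smallK_fac (i) _ _; rewrite -es; case: Cs.
have [R [f [q po]]] := pushout_ex hA e t.
have [R' [f' [q' po']]] := pushout_ex hA e t'.
have [P [b [b' pb]]] := pushout_ex hA q q'.
have eq := pushout_epi po ee; have eq' := pushout_epi po' ee.
have Cq := Ciso_pushout hA po Ce; have Cq' := Ciso_pushout hA po' Ce.
have Cbq : small_epi C (b ∘ q).
  rewrite (pushoutE pb); apply: (Ciso_small hA).
    exact: epi_comp (pushout_epi pb eq) eq'.
  exact: (proj1 (Ciso_comp hA (Ciso_pushout hA pb Cq) Cq')).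
exists (Frac (b ∘ f) Ci Cbq), (b' ∘ f').
split; split=> //; exists e; split=> //=.
  by rewrite -!hcompA (pushoutE po).
by rewrite (pushoutE pb) -!hcompA (pushoutE po').
Qed.

Lemma frac_eq_refl M N (x : frac M N) : frac_eq x x.
Proof.
by have [Q [s [t h]]] := compat_ex x; exact: (compat_frac_eq h h).
Qed.

Lemma frac_eq_sym M N (x y : frac M N) : frac_eq x y -> frac_eq y x.
Proof.
by move=> /frac_eq_compat [Q [s [t [h h']]]]; exact: (compat_frac_eq h' h).
Qed.

Lemma frac_eq_trans M N (y x z : frac M N) :
  frac_eq x y -> frac_eq y z -> frac_eq x z.
Proof.
move=> /frac_eq_compat [Q [s [t [hx hy]]]].
move=> /frac_eq_compat [Q' [s' [t' [hy' hz]]]].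
have [P [w [w' [Cw e1 e2]]]] := compat_common hy hy'.
apply: compat_frac_eq (compat_refine hx Cw) _; rewrite e1 e2.
by apply: compat_refine hz _; rewrite -e1.
Qed.

HB.instance Definition _ M N := gen_eqMixin (frac M N).
HB.instance Definition _ M N := gen_choiceMixin (frac M N).

Definition frac_rel M N : rel (frac M N) := fun x y => `[< frac_eq x y >].

Lemma frac_rel_refl M N : reflexive (@frac_rel M N).
Proof. by move=> x; apply/asboolP/frac_eq_refl. Qed.

Lemma frac_rel_sym M N : symmetric (@frac_rel M N).
Proof. by move=> x y; apply/asboolP/asboolP; apply: frac_eq_sym. Qed.

Lemma frac_rel_trans M N : transitive (@frac_rel M N).
Proof.
by move=> y x z /asboolP h1 /asboolP h2; apply/asboolP/(frac_eq_trans h1 h2).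
Qed.

Canonical frac_equiv M N := EquivRel (@frac_rel M N)
  (@frac_rel_refl M N) (@frac_rel_sym M N) (@frac_rel_trans M N).

(** [Hom_{A/C}(M, N)] *)
Definition qhom (M N : A) := {eq_quot (frac_equiv M N)}.
HB.instance Definition _ M N := Choice.on (qhom M N).

Definition qclass M N (x : frac M N) : qhom M N := \pi_({eq_quot _}) x.
Definition qrepr M N (x : qhom M N) : frac M N := repr x.

Lemma qreprK M N (x : qhom M N) : qclass (qrepr x) = x.
Proof. exact: reprK. Qed.

Lemma qclassP M N (x y : frac M N) : qclass x = qclass y <-> frac_eq x y.
Proof.
by split=> [/eqmodP/asboolP|?] //; apply/eqmodP/asboolP.
Qed.

Lemma frac_idP M : cosmall_mono C (idm M).
Proof.
by apply: Ciso_cosmall => //; [exact: mono_id | case: (Ciso_id C M)].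
Qed.

Lemma frac_idP' M : small_epi C (idm M).
Proof.
by apply: Ciso_small => //; [exact: epi_id | case: (Ciso_id C M)].
Qed.

Definition qT M N (f : Mor M N) : qhom M N :=
  qclass (Frac f (frac_idP M) (frac_idP' N)).

Definition srep M N (x : qhom M N) Q (s : Mor Q M) (t : Mor Q N) : Prop :=
  exists y, x = qclass y /\ compat y s t.

Lemma srep_ex M N (x : qhom M N) :
  exists Q (s : Mor Q M) (t : Mor Q N), srep x s t.
Proof.
have [Q [s [t h]]] := compat_ex (qrepr x).
by exists Q, s, t, (qrepr x); rewrite qreprK.
Qed.

Lemma srep_Ciso M N (x : qhom M N) Q (s : Mor Q M) (t : Mor Q N) :
  srep x s t -> Ciso s.
Proof. by case=> y [_ []]. Qed.

Lemma srep_span M N Q (s : Mor Q M) (t : Mor Q N) : Ciso s ->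
  exists x, srep x s t.
Proof.
move=> /(@frac_of_spans _ _ _ s t t) [x [_ [h _]]].
by exists (qclass x), x.
Qed.

Lemma srep_uniq M N (x y : qhom M N) Q (s : Mor Q M) (t : Mor Q N) :
  srep x s t -> srep y s t -> x = y.
Proof.
move=> [a [-> ha]] [b [-> hb]]; apply/qclassP; exact: compat_frac_eq ha hb.
Qed.

Lemma srep_refine M N (x : qhom M N) Q (s : Mor Q M) (t : Mor Q N)
    P (w : Mor P Q) : srep x s t -> Ciso (s ∘ w) -> srep x (s ∘ w) (t ∘ w).
Proof.
by move=> [a [-> ha]] Cw; exists a; split=> //; apply: compat_refine.
Qed.

Lemma srep_unrefine M N (x : qhom M N) Q (s : Mor Q M) (t : Mor Q N)
    P (w : Mor P Q) : Ciso s -> srep x (s ∘ w) (t ∘ w) -> srep x s t.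
Proof.
move=> Cs hx; have [y hy] := srep_span t Cs.
by rewrite (srep_uniq hx (srep_refine hy (srep_Ciso hx))).
Qed.

Lemma srep_compat M N (y : frac M N) Q (s : Mor Q M) (t : Mor Q N) :
  srep (qclass y) s t ->
  exists P (w : Mor P Q), Ciso (s ∘ w) /\ compat y (s ∘ w) (t ∘ w).
Proof.
move=> [z [/qclassP/frac_eq_compat [R [s' [t' [hy hz]]]] hz']].
have [P [w [w' [Cw e1 e2]]]] := compat_common hz' hz.
exists P, w; split=> //; rewrite e1 e2; apply: compat_refine => //.
by rewrite -e1.
Qed.

Lemma srep_common M N (x : qhom M N) Q (s : Mor Q M) (t : Mor Q N)
    Q' (s' : Mor Q' M) (t' : Mor Q' N) : srep x s t -> srep x s' t' ->
  exists P (w : Mor P Q) (w' : Mor P Q'),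
    [/\ Ciso (s ∘ w), s ∘ w = s' ∘ w' & t ∘ w = t' ∘ w'].
Proof.
move=> [y [-> hy]] /srep_compat [R [r [Cr hy']]].
have [P [w [w' [Cw e1 e2]]]] := compat_common hy hy'.
by exists P, w, (r ∘ w'); split; rewrite ?hcompA.
Qed.

Lemma srep_T M N (f : Mor M N) : srep (qT f) (idm M) f.
Proof.
exists (Frac f (frac_idP M) (frac_idP' N)); split=> //.
by split; [exact: Ciso_id | exists (idm M); rewrite /= !hcomp1m hcompm1].
Qed.

Lemma srep2 M N (x y : qhom M N) : exists Q (s : Mor Q M) (t t' : Mor Q N),
  srep x s t /\ srep y s t'.
Proof.
have [Q [s [t h]]] := srep_ex x; have [Q' [s' [t' h']]] := srep_ex y.
have [P [w [w' [e Cw]]]] := ore hA (srep_Ciso h) (srep_Ciso h').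
exists P, (s ∘ w), (t ∘ w), (t' ∘ w'); split; first exact: srep_refine.
by rewrite e; apply: srep_refine; rewrite -?e.
Qed.

Lemma srep3 M N (x y z : qhom M N) :
  exists Q (s : Mor Q M) (t t' t'' : Mor Q N),
  [/\ srep x s t, srep y s t' & srep z s t''].
Proof.
have [Q [s [t [t1 [h h1]]]]] := srep2 x y.
have [Q' [s' [t' h']]] := srep_ex z.
have [P [w [w' [e Cw]]]] := ore hA (srep_Ciso h) (srep_Ciso h').
exists P, (s ∘ w), (t ∘ w), (t1 ∘ w), (t' ∘ w'); split; try exact: srep_refine.
by rewrite e; apply: srep_refine; rewrite -?e.
Qed.

Definition qadd_spec M N (x y z : qhom M N) : Prop :=
  exists (r : frac M N) (g : Mor (fsub r) (fquo r)),
    [/\ x = qclass r, y = qclass (frac_with g)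
      & z = qclass (frac_with (fmor r + g))].

Lemma qadd_ex M N (x y : qhom M N) : exists z, qadd_spec x y z.
Proof.
have [Q [s [t [t' [hx hy]]]]] := srep2 x y.
have [r [g [h h']]] := frac_of_spans t t' (srep_Ciso hx).
exists (qclass (frac_with (fmor r + g))), r, g; split=> //.
  by apply: srep_uniq hx _; exists r.
by apply: srep_uniq hy _; exists (frac_with g).
Qed.

Definition qadd M N (x y : qhom M N) : qhom M N := projT1 (cid (qadd_ex x y)).

Lemma qaddP M N (x y : qhom M N) : qadd_spec x y (qadd x y).
Proof. exact: projT2 (cid (qadd_ex x y)). Qed.

Definition qscale M N (a : K) (x : qhom M N) : qhom M N :=
  qclass (frac_with (a *: fmor (qrepr x))).

Lemma srep_add M N (x y : qhom M N) Q (s : Mor Q M) (t t' : Mor Q N) :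
  srep x s t -> srep y s t' -> srep (qadd x y) s (t + t').
Proof.
move=> hx hy; have Cs := srep_Ciso hx.
have [r [g [ex ey ->]]] := qaddP x y.
move: hx hy; rewrite ex ey => /srep_compat [P [w [Cw hw]]].
move=> /(srep_refine)/(_ Cw)/srep_compat [P' [w' [Cw' [_ [u' [e1' e2']]]]]].
have [_ [u [e1 e2]]] := compat_refine hw Cw'.
apply: (@srep_unrefine _ _ _ _ _ _ P' (w ∘ w')) => //.
exists (frac_with (fmor r + g)); split=> //; split; first by rewrite hcompA.
have uu : u = u' by apply: (proj1 (fmonoP r)); rewrite e1.
exists u; rewrite /= !hcompA !(hcompDl, hcompDr) -e1; split=> //.
by move: e2 e2'; rewrite /= -uu !hcompA => -> ->.
Qed.

Lemma srep_scale M N a (x : qhom M N) Q (s : Mor Q M) (t : Mor Q N) :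
  srep x s t -> srep (qscale a x) s (a *: t).
Proof.
move=> hx; have Cs := srep_Ciso hx.
move: hx; rewrite -{1}(qreprK x) => /srep_compat [P [w [Cw [_ [u [e1 e2]]]]]].
apply: (@srep_unrefine _ _ _ _ _ _ P w) => //.
exists (frac_with (a *: fmor (qrepr x))); split=> //; split=> //.
by exists u; rewrite /= !(hcompZl, hcompZr) e2.
Qed.

Lemma qaddA M N : associative (@qadd M N).
Proof.
move=> x y z; have [Q [s [t1 [t2 [t3 [h1 h2 h3]]]]]] := srep3 x y z.
apply: srep_uniq (srep_add h1 (srep_add h2 h3)) _; rewrite addrA.
exact: srep_add (srep_add h1 h2) h3.
Qed.

Lemma qaddC M N : commutative (@qadd M N).
Proof.
move=> x y; have [Q [s [t1 [t2 [h1 h2]]]]] := srep2 x y.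
by apply: srep_uniq (srep_add h1 h2) _; rewrite addrC; apply: srep_add.
Qed.

Lemma srep_zero M N Q (s : Mor Q M) : Ciso s ->
  srep (qT (0 : Mor M N)) s 0.
Proof.
move=> Cs; have := @srep_refine _ _ _ _ _ _ Q s (srep_T (0 : Mor M N)).
by rewrite hcomp1m hcomp0m; apply.
Qed.

Lemma qadd0 M N : left_id (qT (0 : Mor M N)) (@qadd M N).
Proof.
move=> x; have [Q [s [t h]]] := srep_ex x.
have := srep_add (srep_zero N (srep_Ciso h)) h; rewrite add0r => h'.
exact: srep_uniq h' h.
Qed.

Lemma qaddN M N : left_inverse (qT (0 : Mor M N)) (qscale (-1)) (@qadd M N).
Proof.
move=> x; have [Q [s [t h]]] := srep_ex x.
have := srep_add (srep_scale (-1) h) h; rewrite scaleN1r addNr => h'.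
exact: srep_uniq h' (srep_zero N (srep_Ciso h)).
Qed.

HB.instance Definition _ M N :=
  GRing.isZmodule.Build (qhom M N) (@qaddA M N) (@qaddC M N) (@qadd0 M N)
    (@qaddN M N).

Lemma qscaleA M N a b (x : qhom M N) :
  qscale a (qscale b x) = qscale (a * b) x.
Proof.
have [Q [s [t h]]] := srep_ex x.
have := srep_scale a (srep_scale b h); rewrite scalerA => h'.
exact: srep_uniq h' (srep_scale _ h).
Qed.

Lemma qscale1 M N : left_id 1 (@qscale M N).
Proof.
move=> x; have [Q [s [t h]]] := srep_ex x.
have := srep_scale 1 h; rewrite scale1r => h'; exact: srep_uniq h' h.
Qed.

Lemma qscaleDr M N : right_distributive (@qscale M N) +%R.
Proof.
move=> a x y; have [Q [s [t1 [t2 [h1 h2]]]]] := srep2 x y.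
apply: srep_uniq (srep_scale a (srep_add h1 h2)) _; rewrite scalerDr.
exact: srep_add (srep_scale a h1) (srep_scale a h2).
Qed.

Lemma qscaleDl M N (x : qhom M N) :
  {morph (@qscale M N)^~ x : a b / a + b}.
Proof.
move=> a b; have [Q [s [t h]]] := srep_ex x.
apply: srep_uniq (srep_scale (a + b) h) _; rewrite scalerDl.
exact: srep_add (srep_scale a h) (srep_scale b h).
Qed.

HB.instance Definition _ M N :=
  GRing.Zmodule_isLmodule.Build K (qhom M N) (@qscaleA M N) (@qscale1 M N)
    (@qscaleDr M N) (@qscaleDl M N).

(** The composite of the classes of [f : M' → N/N'] and [g : N'' → P/P']
    is the class of [b ∘ a] when [f] and [g] factor as [a : M' → I] and
    [b : I → P/P'] through the image [I] of [N'' → N → N/N']. *)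
Definition qcomp_spec M N P (y : qhom N P) (x : qhom M N) (z : qhom M P) :
    Prop :=
  exists (f : frac M N) (g : frac N P) (I : A)
    (e : Mor (fsub g) I) (j : Mor I (fquo f))
    (a : Mor (fsub f) I) (b : Mor I (fquo g)),
    [/\ x = qclass f, y = qclass g,
        [/\ epi e, mono j & fepi f ∘ fmono g = j ∘ e],
        fmor f = j ∘ a /\ fmor g = b ∘ e
      & z = qclass (Frac (b ∘ a) (fmonoP f) (fepiP g))].

Lemma qcomp_ex M N P (y : qhom N P) (x : qhom M N) : exists z, qcomp_spec y x z.
Proof.
pose f := qrepr x; pose g := qrepr y.
have Cqn : Ciso (fepi f ∘ fmono g).
  exact: (Ciso_comp hA (small_Ciso (fepiP f)) (cosmall_Ciso (fmonoP g))).
have [I [e [j [ee mj eqn]]]] := image_ex hA (fepi f ∘ fmono g).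
have Ce : Ciso e.
  split; last exact: epi_smallC.
  by apply: smallK_fac (j) _ _; rewrite -eqn; case: Cqn.
have Cj : Ciso j.
  split; first exact: mono_smallK.
  by apply: smallC_fac (e) _; rewrite -eqn; case: Cqn.
have [S [m [a [pb Cm]]]] := ore_pullback hA (fmor f) Cj.
have [R [b [q po]]] := pushout_ex hA e (fmor g).
have mm : mono m.
  apply: monoP => W z mz; apply: (pullback_joint pb) => //.
  by apply: (mono0 mj); rewrite hcompA (proj1 pb) -hcompA mz hcompm0.
have Cmm : cosmall_mono C (fmono f ∘ m).
  apply: Ciso_cosmall => //; first exact: mono_comp (proj1 (fmonoP f)) mm.
  exact: (proj2 (Ciso_comp hA (cosmall_Ciso (fmonoP f)) Cm)).
have Cq : small_epi C (q ∘ fepi g).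
  apply: Ciso_small => //.
    exact: epi_comp (pushout_epi po ee) (proj1 (fepiP g)).
  exact: (proj1 (Ciso_comp hA (Ciso_pushout hA po Ce) (small_Ciso (fepiP g)))).
exists (qclass (Frac (b ∘ a) Cmm Cq)).
exists (Frac (fmor f ∘ m) Cmm (fepiP f)), (Frac (q ∘ fmor g) (fmonoP g) Cq).
exists I, e, j, a, b; split=> //=.
- rewrite -(qreprK x); apply/qclassP.
  exists S, (fquo f), m, (idm _), (idm _), (idm _).
  by rewrite /= !hcomp1m !hcompm1; split=> //; exact: (fepiP f).
- rewrite -(qreprK y); apply/qclassP.
  exists (fsub g), R, (idm _), (idm _), q, (idm _).
  by rewrite /= !hcomp1m !hcompm1; split=> //; exact: (fmonoP g).
- by split; [rewrite (proj1 pb) | rewrite (pushoutE po)].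
Qed.

Definition qcomp M N P (y : qhom N P) (x : qhom M N) : qhom M P :=
  projT1 (cid (qcomp_ex y x)).

Lemma qcompP M N P (y : qhom N P) (x : qhom M N) : qcomp_spec y x (qcomp y x).
Proof. exact: projT2 (cid (qcomp_ex y x)). Qed.

Lemma srep_comp M N P (x : qhom M N) (y : qhom N P)
    Q (s : Mor Q M) (t : Mor Q N) Q' (s' : Mor Q' N) (t' : Mor Q' P)
    R (v : Mor R Q) (w : Mor R Q') :
  srep x s t -> srep y s' t' -> t ∘ v = s' ∘ w -> Ciso (s ∘ v) ->
  srep (qcomp y x) (s ∘ v) (t' ∘ w).
Proof.
move=> hx hy etv Csv.
have [f [g [I [e [j [a [b [ex ey [ee mj eqn] [ef eg] ez]]]]]]]] := qcompP y x.
set z := qcomp y x in ez *.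
have Cqn : Ciso (fepi f ∘ fmono g).
  exact: (Ciso_comp hA (small_Ciso (fepiP f)) (cosmall_Ciso (fmonoP g))).
have Ce : Ciso e.
  split; last exact: epi_smallC.
  by apply: smallK_fac (j) _ _; rewrite -eqn; case: Cqn.
have [S [u [v1 [pb Cu]]]] := ore_pullback hA a Ce.
have [S' [u' [t1' [pb' Cu']]]] := ore_pullback hA (fmor g) (small_Ciso (fepiP g)).
have [L [l [l' [pl Cl]]]] := ore_pullback hA v1 Cu'.
pose s1 := fmono f ∘ u; pose t1 := fmono g ∘ v1; pose s1' := fmono g ∘ u'.
have hx1 : srep x s1 t1.
  exists f; split=> //; split.
    exact: (Ciso_comp hA (cosmall_Ciso (fmonoP f)) Cu).
  by exists u; split=> //; rewrite /t1 hcompA eqn -hcompA (proj1 pb) ef hcompA.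
have hy1 : srep y s1' t1'.
  exists g; split=> //; split.
    exact: (Ciso_comp hA (cosmall_Ciso (fmonoP g)) Cu').
  by exists u'; split=> //; rewrite (proj1 pb').
have et1 : t1 ∘ l = s1' ∘ l' by rewrite /t1 /s1' -!hcompA (proj1 pl).
have Cs1l : Ciso (s1 ∘ l).
  by apply: (Ciso_comp hA) => //; apply: (srep_Ciso hx1).
have hz1 : srep z (s1 ∘ l) (t1' ∘ l').
  exists (Frac (b ∘ a) (fmonoP f) (fepiP g)); split=> //; split=> //.
  exists (u ∘ l); split=> /=; first by rewrite hcompA.
  rewrite hcompA (proj1 pb') -hcompA (proj1 pl) eg -hcompA (hcompA e).
  by rewrite (proj1 pb) !hcompA.
have [T1 [p [p' [Cp ep1 ep2]]]] :=
  srep_common (srep_refine hx Csv) (srep_refine hx1 Cs1l).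
have [T2 [r [r' [Cr er1 er2]]]] := srep_common hy hy1.
have [T3 [d [d' [pd Cd]]]] := ore_pullback hA (s' ∘ w ∘ p) Cr.
have ed := proj1 pd.
have [|T4 [k [Ck ek]]] := @ore_cancel _ _ hA C _ _ _ s' (w ∘ p ∘ d) (r ∘ d')
    (proj1 (srep_Ciso hy)).
  by rewrite !hcompA ed.
have [|T5 [k' [Ck' ek']]] := @ore_cancel _ _ hA C _ _ _ s1'
    (l' ∘ p' ∘ d ∘ k) (r' ∘ d' ∘ k) (proj1 (srep_Ciso hy1)).
  by rewrite !hcompA -et1 -ep2 -er1 ed -etv.
have Cfin : Ciso (s ∘ v ∘ (p ∘ d ∘ k ∘ k')).
  rewrite !hcompA; do 3 (apply: Ciso_comp => //).
apply: (@srep_unrefine _ _ _ _ _ _ T5 (p ∘ d ∘ k ∘ k')) => //.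
have -> : s ∘ v ∘ (p ∘ d ∘ k ∘ k') = s1 ∘ l ∘ (p' ∘ d ∘ k ∘ k').
  by rewrite !hcompA ep1.
have -> : t' ∘ w ∘ (p ∘ d ∘ k ∘ k') = t1' ∘ l' ∘ (p' ∘ d ∘ k ∘ k').
  have -> : t' ∘ w ∘ (p ∘ d ∘ k ∘ k') = t' ∘ (w ∘ p ∘ d ∘ k) ∘ k'.
    by rewrite !hcompA.
  have -> : t1' ∘ l' ∘ (p' ∘ d ∘ k ∘ k') = t1' ∘ (l' ∘ p' ∘ d ∘ k ∘ k').
    by rewrite !hcompA.
  by rewrite ek ek' !hcompA er2.
apply: srep_refine hz1 _.
by move: Cfin; rewrite !hcompA ep1.
Qed.

Lemma qcompA X Y Z W (h : qhom Z W) (g : qhom Y Z) (f : qhom X Y) :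
  qcomp h (qcomp g f) = qcomp (qcomp h g) f.
Proof.
have [Q1 [s1 [t1 h1]]] := srep_ex f; have [Q2 [s2 [t2 h2]]] := srep_ex g.
have [Q3 [s3 [t3 h3]]] := srep_ex h.
have [P [v [w [pb Cv]]]] := ore_pullback hA t1 (srep_Ciso h2).
have [R [v' [w' [pb' Cv']]]] := ore_pullback hA (t2 ∘ w) (srep_Ciso h3).
have [L [a [b [pl Ca]]]] := ore_pullback hA t2 (srep_Ciso h3).
have [r [er1 er2]] : exists r, b ∘ r = w' /\ a ∘ r = w ∘ v'.
  by apply: (pullback_fac pl); rewrite (proj1 pb') hcompA.
have C1 : Ciso (s1 ∘ v) by apply: Ciso_comp => //; apply: srep_Ciso h1.
have C2 : Ciso (s1 ∘ v ∘ v') by apply: Ciso_comp.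
have C3 : Ciso (s2 ∘ a) by apply: Ciso_comp => //; apply: srep_Ciso h2.
have e1 := srep_comp h1 h2 (esym (proj1 pb)) C1.
have e2 := srep_comp e1 h3 (esym (proj1 pb')) C2.
have e3 := srep_comp h2 h3 (esym (proj1 pl)) C3.
have := @srep_comp _ _ _ _ _ _ _ _ _ _ _ R (v ∘ v') r h1 e3.
rewrite hcompA -(proj1 pb) -!hcompA er2 er1 => e4.
rewrite -hcompA in e2.
by apply: srep_uniq e2 (e4 erefl _); rewrite hcompA.
Qed.

Lemma qcomp1m X Y (f : qhom X Y) : qcomp (qT (idm Y)) f = f.
Proof.
have [Q [s [t h]]] := srep_ex f.
have := @srep_comp _ _ _ _ _ _ _ _ _ _ _ Q (idm Q) t h (srep_T (idm Y)).
rewrite !hcomp1m !hcompm1 => h'.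
exact: srep_uniq (h' erefl (srep_Ciso h)) h.
Qed.

Lemma qcompm1 X Y (f : qhom X Y) : qcomp f (qT (idm X)) = f.
Proof.
have [Q [s [t h]]] := srep_ex f.
have := @srep_comp _ _ _ _ _ _ _ _ _ _ _ Q s (idm Q) (srep_T (idm X)) h.
rewrite !hcomp1m !hcompm1 => h'.
exact: srep_uniq (h' erefl (srep_Ciso h)) h.
Qed.

Lemma qcomp_linl X Y Z (a : K) (g g' : qhom Y Z) (f : qhom X Y) :
  qcomp (a *: g + g') f = a *: qcomp g f + qcomp g' f.
Proof.
have [Q1 [s1 [t1 h1]]] := srep_ex f.
have [Q2 [s2 [t2 [t2' [h2 h2']]]]] := srep2 g g'.
have [P [v [w [pb Cv]]]] := ore_pullback hA t1 (srep_Ciso h2).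
have C1 : Ciso (s1 ∘ v) by apply: Ciso_comp => //; apply: srep_Ciso h1.
have epb := esym (proj1 pb).
have e := srep_comp h1 (srep_add (srep_scale a h2) h2') epb C1.
apply: srep_uniq e _; rewrite hcomp_linl; apply: srep_add.
  by apply: srep_scale; apply: srep_comp epb C1.
exact: srep_comp epb C1.
Qed.

Lemma qcomp_linr X Y Z (a : K) (g : qhom Y Z) (f f' : qhom X Y) :
  qcomp g (a *: f + f') = a *: qcomp g f + qcomp g f'.
Proof.
have [Q1 [s1 [t1 [t1' [h1 h1']]]]] := srep2 f f'.
have [Q2 [s2 [t2 h2]]] := srep_ex g.
have [P [v [w [pb Cv]]]] := ore_pullback hA t1 (srep_Ciso h2).
have [R [v' [w' [pb' Cv']]]] := ore_pullback hA (t1' ∘ v) (srep_Ciso h2).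
have epb := esym (proj1 pb); have epb' := esym (proj1 pb').
have C1 : Ciso (s1 ∘ (v ∘ v')).
  by rewrite hcompA; do 2 apply: Ciso_comp => //; apply: srep_Ciso h1.
have e1 := @srep_comp _ _ _ _ _ _ _ _ _ _ _ R (v ∘ v') (w ∘ v') h1 h2.
have e1' := @srep_comp _ _ _ _ _ _ _ _ _ _ _ R (v ∘ v') w' h1' h2.
have := @srep_comp _ _ _ _ _ _ _ _ _ _ _ R (v ∘ v') (a *: (w ∘ v') + w')
  (srep_add (srep_scale a h1) h1') h2.
rewrite hcomp_linl !hcomp_linr => e.
apply: srep_uniq (e _ C1) _.
  by rewrite !hcompA epb epb'.
apply: srep_add; first apply: srep_scale.
  by apply: e1 => //; rewrite !hcompA epb.
by apply: e1' => //; rewrite !hcompA.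
Qed.

End Quotient.

Definition quotient_lin (K : fieldType) (A : linCat K) (hA : abelian_cat A)
    (C : serre A) : linCat K :=
  LinCat (Mor := fun M N => qhom hA C M N : lmodType K)
    (@qcompA K A hA C) (@qcomp1m K A hA C) (@qcompm1 K A hA C)
    (@qcomp_linl K A hA C) (@qcomp_linr K A hA C).

Record linFunctor (K : fieldType) (A B : linCat K) := LinFunctor {
  fobj :> A -> B;
  fmap : forall X Y, Mor X Y -> Mor (fobj X) (fobj Y);
  fmap_id : forall X, fmap (idm X) = idm (fobj X);
  fmap_comp : forall X Y Z (g : Mor Y Z) (f : Mor X Y),
    fmap (g ∘ f) = fmap g ∘ fmap f;
  fmap_linear : forall X Y (a : K) (f g : Mor X Y),
    fmap (a *: f + g) = a *: fmap f + fmap g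
}.

Definition nat_iso (K : fieldType) (A B : linCat K) (F G : linFunctor A B) :
    Prop :=
  exists eta : forall X, Mor (F X) (G X),
    (forall X, is_iso (eta X)) /\
    (forall X Y (f : Mor X Y), eta Y ∘ fmap F f = fmap G f ∘ eta X).

Definition id_functor (K : fieldType) (A : linCat K) : linFunctor A A :=
  @LinFunctor K A A (fun X => X) (fun X Y f => f)
    (fun X => erefl) (fun X Y Z g f => erefl) (fun X Y a f g => erefl).

Program Definition comp_functor (K : fieldType) (A B D : linCat K)
    (G : linFunctor B D) (F : linFunctor A B) : linFunctor A D :=
  @LinFunctor K A D (fun X => G (F X)) (fun X Y f => fmap G (fmap F f)) _ _ _.
Next Obligation. by move=> *; rewrite !fmap_id. Qed.
Next Obligation. by move=> *; rewrite !fmap_comp. Qed.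
Next Obligation. by move=> *; rewrite !fmap_linear. Qed.

Definition is_equivalence (K : fieldType) (A B : linCat K)
    (F : linFunctor A B) : Prop :=
  exists G : linFunctor B A,
    nat_iso (comp_functor G F) (id_functor A) /\
    nat_iso (comp_functor F G) (id_functor B).

Definition equivalent (K : fieldType) (A B : linCat K) : Prop :=
  exists F : linFunctor A B, is_equivalence F.

Definition full_subcat (K : fieldType) (A : linCat K) (P : A -> Prop) :
    linCat K :=
  @LinCat K {X : A | P X} (fun X Y => Mor (sval X) (sval Y))
    (fun X => idm (sval X)) (fun X Y Z g f => g ∘ f)
    (fun X Y Z W => @hcompA K A _ _ _ _) (fun X Y => @hcomp1m K A _ _)
    (fun X Y => @hcompm1 K A _ _) (fun X Y Z => @hcomp_linl K A _ _ _)
    (fun X Y Z => @hcomp_linr K A _ _ _).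

Section Restriction.
Variables (K : fieldType) (A B : linCat K) (F : linFunctor A B).
Variable P : A -> Prop.

Definition restrict : linFunctor (full_subcat P) B :=
  @LinFunctor K (full_subcat P) B (fun X => F (sval X)) (fun X Y f => fmap F f)
    (fun X => fmap_id F (sval X)) (fun X Y Z g f => fmap_comp F g f)
    (fun X Y a f g => fmap_linear F a f g).

Definition birestrict (Q : B -> Prop) (FPQ : forall X, P X -> Q (F X)) :
    linFunctor (full_subcat P) (full_subcat Q) :=
  @LinFunctor K (full_subcat P) (full_subcat Q)
    (fun X => exist Q (F (sval X)) (FPQ _ (svalP X))) (fun X Y f => fmap F f)
    (fun X => fmap_id F (sval X)) (fun X Y Z g f => fmap_comp F g f)
    (fun X Y a f g => fmap_linear F a f g).

End Restriction.

Record monCat (K : fieldType) := MonCat {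
  mon_cat :> linCat K;
  tens : mon_cat -> mon_cat -> mon_cat;
  tensm : forall X X' Y Y', Mor X X' -> Mor Y Y' ->
    Mor (tens X Y) (tens X' Y');
  munit : mon_cat;
  massoc : forall X Y Z, iso (tens (tens X Y) Z) (tens X (tens Y Z));
  mlunit : forall X, iso (tens munit X) X;
  mrunit : forall X, iso (tens X munit) X;
  tensm_id : forall X Y, tensm (idm X) (idm Y) = idm (tens X Y);
  tensm_comp : forall X X' X'' Y Y' Y'' (g : Mor X' X'') (f : Mor X X')
      (g' : Mor Y' Y'') (f' : Mor Y Y'),
    tensm (g ∘ f) (g' ∘ f') = tensm g g' ∘ tensm f f';
  massoc_nat : forall X X' Y Y' Z Z' (f : Mor X X') (g : Mor Y Y')
      (h : Mor Z Z'),
    massoc X' Y' Z' ∘ tensm (tensm f g) h =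
    tensm f (tensm g h) ∘ massoc X Y Z;
  mlunit_nat : forall X Y (f : Mor X Y),
    mlunit Y ∘ tensm (idm munit) f = f ∘ mlunit X;
  mrunit_nat : forall X Y (f : Mor X Y),
    mrunit Y ∘ tensm f (idm munit) = f ∘ mrunit X;
  mpentagon : forall W X Y Z,
    massoc W X (tens Y Z) ∘ massoc (tens W X) Y Z =
    tensm (idm W) (massoc X Y Z) ∘ massoc W (tens X Y) Z
      ∘ tensm (massoc W X Y) (idm Z);
  mtriangle : forall X Y,
    tensm (idm X) (mlunit Y) ∘ massoc X munit Y = tensm (mrunit X) (idm Y)
}.
Arguments munit {K} _.
Notation "X ⊗ Y" := (tens X Y) : cat_scope.
Notation "f ⊠ g" := (tensm f g) : cat_scope.

(** [F] with structure morphisms [J : F X ⊗ F Y → F (X ⊗ Y)] and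
    [phi : 1 → F 1] is a (strong) monoidal functor. *)
Definition is_monoidal (K : fieldType) (A B : monCat K) (F : linFunctor A B)
    (J : forall X Y, Mor (F X ⊗ F Y) (F (X ⊗ Y)))
    (phi : Mor (munit B) (F (munit A))) : Prop :=
  [/\ (forall X Y, is_iso (J X Y)) /\ is_iso phi,
      forall X X' Y Y' (f : Mor X X') (g : Mor Y Y'),
        J X' Y' ∘ (fmap F f ⊠ fmap F g) = fmap F (f ⊠ g) ∘ J X Y,
      forall X Y Z,
        fmap F (massoc X Y Z) ∘ J (X ⊗ Y) Z ∘ (J X Y ⊠ idm (F Z)) =
        J X (Y ⊗ Z) ∘ (idm (F X) ⊠ J Y Z) ∘ massoc (F X) (F Y) (F Z),
      forall X, fmap F (mlunit X) ∘ J (munit A) X ∘ (phi ⊠ idm (F X)) =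
        mlunit (F X)
    & forall X, fmap F (mrunit X) ∘ J X (munit A) ∘ (idm (F X) ⊠ phi) =
        mrunit (F X)].

Section MonoidalDefs.
Variables (K : fieldType) (A : monCat K).

Definition is_left_dual (X X' : A) (ev : Mor (X' ⊗ X) (munit A))
    (coev : Mor (munit A) (X ⊗ X')) : Prop :=
  mrunit X ∘ (idm X ⊠ ev) ∘ massoc X X' X ∘ (coev ⊠ idm X)
    ∘ ibwd (mlunit X) = idm X /\
  mlunit X' ∘ (ev ⊠ idm X') ∘ ibwd (massoc X' X X') ∘ (idm X' ⊠ coev)
    ∘ ibwd (mrunit X') = idm X'.

Definition has_left_duals : Prop :=
  forall X : A, exists (X' : A) ev coev, @is_left_dual X X' ev coev.

Definition primitive_idempotent (X : A) (e : Mor X X) : Prop :=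
  [/\ e <> 0, e ∘ e = e
    & forall e1 e2 : Mor X X, e1 ∘ e1 = e1 -> e2 ∘ e2 = e2 ->
        e1 ∘ e2 = 0 -> e2 ∘ e1 = 0 -> e = e1 + e2 -> e1 = 0 \/ e2 = 0].

(** [1 = ⊕_i one i], the idempotents [inj i ∘ prj i] of which [one i] is the
    image being exactly the primitive idempotents of [End(1)]. *)
Definition unit_decomposition (I : finType) (one : I -> A)
    (inj : forall i, Mor (one i) (munit A))
    (prj : forall i, Mor (munit A) (one i)) : Prop :=
  [/\ is_biproduct inj prj,
      injective (fun i => inj i ∘ prj i)
    & forall e : Mor (munit A) (munit A),
        primitive_idempotent e <-> exists i, e = inj i ∘ prj i].

Definition component (I : finType) (one : I -> A) (i j : I) (X : A) : Prop :=
  exists Y, isomorphic X (one i ⊗ Y ⊗ one j).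

Record tensorIdeal := TensorIdeal {
  ti_serre :> serre A;
  ti_tensl : forall X Y : A, ti_serre Y -> ti_serre (X ⊗ Y);
  ti_tensr : forall X Y : A, ti_serre Y -> ti_serre (Y ⊗ X)
}.

End MonoidalDefs.

Record multiringCat (K : fieldType) := MultiringCat {
  mr_mon :> monCat K;
  mr_abelian : abelian_cat mr_mon;
  mr_locfin : locally_finite mr_mon;
  mr_linl : forall (X X' Y Y' : mr_mon) a (f f' : Mor X X') (g : Mor Y Y'),
    (a *: f + f') ⊠ g = a *: (f ⊠ g) + f' ⊠ g;
  mr_linr : forall (X X' Y Y' : mr_mon) a (f : Mor X X') (g g' : Mor Y Y'),
    f ⊠ (a *: g + g') = a *: (f ⊠ g) + f ⊠ g';
  mr_exactl : forall (W X Y Z : mr_mon) (i : Mor X Y) (p : Mor Y Z),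
    short_exact i p -> short_exact (idm W ⊠ i) (idm W ⊠ p);
  mr_exactr : forall (W X Y Z : mr_mon) (i : Mor X Y) (p : Mor Y Z),
    short_exact i p -> short_exact (i ⊠ idm W) (p ⊠ idm W)
}.

Section SubMonoidal.
Variables (K : fieldType) (A : monCat K) (P : A -> Prop).
Variables (U : A) (u : Mor U (munit A)).

(** [P] is closed under [⊗], and [U ∈ P] is a unit object for it by means of
    [U ⊗ X → 1 ⊗ X → X] and [X ⊗ U → X ⊗ 1 → X]. *)
Record sub_unital : Prop := SubUnital {
  su_unit : P U;
  su_tens : forall X Y, P X -> P Y -> P (X ⊗ Y);
  su_lunit : forall X, P X -> is_iso (mlunit X ∘ (u ⊠ idm X));
  su_runit : forall X, P X -> is_iso (mrunit X ∘ (idm X ⊠ u))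
}.

Definition iso_of (B : linCat K) (X Y : B) (f : Mor X Y) (h : is_iso f) :
    iso X Y :=
  Iso (proj1 (projT2 (cid h))) (proj2 (projT2 (cid h))).

Variable hU : sub_unital.

Definition sub_mon : monCat K.
Proof.
refine (@MonCat K (full_subcat P)
  (fun X Y => exist P (sval X ⊗ sval Y) (su_tens hU (svalP X) (svalP Y)))
  (fun X X' Y Y' f g => f ⊠ g) (exist P U (su_unit hU))
  (fun X Y Z => @Iso K (full_subcat P) (exist P _ _) (exist P _ _)
    (massoc (sval X) (sval Y) (sval Z)) (ibwd (massoc (sval X) (sval Y) (sval Z)))
    (ifwdK (massoc (sval X) (sval Y) (sval Z)))
    (ibwdK (massoc (sval X) (sval Y) (sval Z))))
  (fun X => @iso_of (full_subcat P) (exist P _ _) X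
    (mlunit (sval X) ∘ (u ⊠ idm (sval X))) (su_lunit hU (svalP X)))
  (fun X => @iso_of (full_subcat P) (exist P _ _) X
    (mrunit (sval X) ∘ (idm (sval X) ⊠ u)) (su_runit hU (svalP X)))
  _ _ _ _ _ _ _).
- by move=> X Y; apply: tensm_id.
- by move=> *; apply: tensm_comp.
- by move=> *; apply: massoc_nat.
- move=> X Y f /=; rewrite -hcompA -tensm_comp hcomp1m hcompm1.
  by rewrite hcompA -mlunit_nat -hcompA -tensm_comp hcomp1m hcompm1.
- move=> X Y f /=; rewrite -hcompA -tensm_comp hcomp1m hcompm1.
  by rewrite hcompA -mrunit_nat -hcompA -tensm_comp hcomp1m hcompm1.
- by move=> *; apply: mpentagon.
move=> X Y /=; rewrite -{1}(hcomp1m (idm (sval X))) tensm_comp -hcompA.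
rewrite -massoc_nat hcompA mtriangle -tensm_comp.
by rewrite hcompm1.
Defined.

End SubMonoidal.

Section MonoidalQuotient.
Variables (K : fieldType) (A : multiringCat K) (C : tensorIdeal A).
Let hA := mr_abelian A.
Local Notation qhom := (qhom hA C).
Local Notation Ciso := (Ciso C).
Local Notation srep := (@srep K A hA C _ _).
Local Notation qT := (qT hA C).

Lemma cosmall_tensl W X Y (m : Mor X Y) : cosmall_mono C m ->
  cosmall_mono C (idm W ⊠ m).
Proof.
move=> [mm [Q [c [hc CQ]]]].
have [h1 h2] := mr_exactl W (conj (mono_kernel hA mm hc) hc).
split; first exact: kernel_mono h1.
by exists (W ⊗ Q), (idm W ⊠ c); split=> //; apply: ti_tensl.
Qed.

Lemma cosmall_tensr W X Y (m : Mor X Y) : cosmall_mono C m ->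
  cosmall_mono C (m ⊠ idm W).
Proof.
move=> [mm [Q [c [hc CQ]]]].
have [h1 h2] := mr_exactr W (conj (mono_kernel hA mm hc) hc).
split; first exact: kernel_mono h1.
by exists (Q ⊗ W), (c ⊠ idm W); split=> //; apply: ti_tensr.
Qed.

Lemma small_tensl W X Y (q : Mor X Y) : small_epi C q ->
  small_epi C (idm W ⊠ q).
Proof.
move=> [eq [N [k [hk CN]]]].
have [h1 h2] := mr_exactl W (conj hk (epi_cokernel hA eq hk)).
split; first exact: cokernel_epi h2.
by exists (W ⊗ N), (idm W ⊠ k); split=> //; apply: ti_tensl.
Qed.

Lemma small_tensr W X Y (q : Mor X Y) : small_epi C q ->
  small_epi C (q ⊠ idm W).
Proof.
move=> [eq [N [k [hk CN]]]].
have [h1 h2] := mr_exactr W (conj hk (epi_cokernel hA eq hk)).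
split; first exact: cokernel_epi h2.
by exists (N ⊗ W), (k ⊠ idm W); split=> //; apply: ti_tensr.
Qed.

Lemma tensm_split (X X' Y Y' : A) (f : Mor X X') (g : Mor Y Y') :
  f ⊠ g = (f ⊠ idm Y') ∘ (idm X ⊠ g).
Proof. by rewrite -tensm_comp hcompm1 hcomp1m. Qed.

Lemma cosmall_tens (X X' Y Y' : A) (m : Mor X X') (n : Mor Y Y') :
  cosmall_mono C m -> cosmall_mono C n -> cosmall_mono C (m ⊠ n).
Proof.
move=> /(cosmall_tensr Y') hm /(cosmall_tensl X) hn.
rewrite tensm_split; apply: Ciso_cosmall => //.
  exact: mono_comp (proj1 hm) (proj1 hn).
exact: (proj2 (Ciso_comp hA (cosmall_Ciso hm) (cosmall_Ciso hn))).
Qed.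

Lemma small_tens (X X' Y Y' : A) (q : Mor X X') (r : Mor Y Y') :
  small_epi C q -> small_epi C r -> small_epi C (q ⊠ r).
Proof.
move=> /(small_tensr Y') hm /(small_tensl X) hn.
rewrite tensm_split; apply: Ciso_small => //.
  exact: epi_comp (proj1 hm) (proj1 hn).
exact: (proj1 (Ciso_comp hA (small_Ciso hm) (small_Ciso hn))).
Qed.

Lemma Ciso_factor (X Y : A) (s : Mor X Y) : Ciso s ->
  exists I (e : Mor X I) (i : Mor I Y),
    [/\ small_epi C e, cosmall_mono C i & s = i ∘ e].
Proof.
move=> [Ks Cs]; have [I [e [i [ee mi es]]]] := image_ex hA s.
exists I, e, i; split=> //.
  by apply: Ciso_small => //; apply: smallK_fac (i) _ _; rewrite -es.
by apply: Ciso_cosmall => //; apply: smallC_fac (e) _; rewrite -es.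
Qed.

Lemma Ciso_tens (X X' Y Y' : A) (s : Mor X X') (t : Mor Y Y') :
  Ciso s -> Ciso t -> Ciso (s ⊠ t).
Proof.
move=> /Ciso_factor [I [e [i [he hi ->]]]] /Ciso_factor [I' [e' [i' [he' hi' ->]]]].
rewrite tensm_comp; apply: Ciso_comp => //.
  exact/cosmall_Ciso/cosmall_tens.
exact/small_Ciso/small_tens.
Qed.

(** [M' ⊗ X' → (N/N') ⊗ (Y/Y')] *)
Definition frac_tens M N X Y (f : frac C M N) (g : frac C X Y) :
  frac C (M ⊗ X) (N ⊗ Y) :=
  Frac (fmor f ⊠ fmor g) (cosmall_tens (fmonoP f) (fmonoP g))
    (small_tens (fepiP f) (fepiP g)).

Definition qtens M N X Y (x : qhom M N) (y : qhom X Y) :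
    qhom (M ⊗ X) (N ⊗ Y) :=
  qclass hA (frac_tens (qrepr x) (qrepr y)).

Lemma srep_tens (M N X Y : A) (x : qhom M N) (y : qhom X Y)
    Q (s : Mor Q M) (t : Mor Q N) Q' (s' : Mor Q' X) (t' : Mor Q' Y) :
  srep x s t -> srep y s' t' -> srep (qtens x y) (s ⊠ s') (t ⊠ t').
Proof.
move=> hx hy; have Cs := srep_Ciso hx; have Cs' := srep_Ciso hy.
move: hx hy; rewrite -{1}(qreprK x) -{1}(qreprK y).
move=> /srep_compat [P [w [Cw [_ [u [e1 e2]]]]]].
move=> /srep_compat [P' [w' [Cw' [_ [u' [e1' e2']]]]]].
apply: (@srep_unrefine _ _ _ _ _ _ _ _ _ _ (P ⊗ P') (w ⊠ w')).
  exact: Ciso_tens.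
exists (frac_tens (qrepr x) (qrepr y)); split=> //; rewrite -!tensm_comp.
split; first exact: Ciso_tens.
by exists (u ⊠ u'); rewrite /= -!tensm_comp e1 e1' e2 e2'.
Qed.

Lemma qtens_class M N X Y (f : frac C M N) (g : frac C X Y) :
  qtens (qclass hA f) (qclass hA g) = qclass hA (frac_tens f g).
Proof.
have [Q [s [t h]]] := compat_ex hA f; have [Q' [s' [t' h']]] := compat_ex hA g.
have hx : srep (qclass hA f) s t by exists f.
have hy : srep (qclass hA g) s' t' by exists g.
apply: srep_uniq (srep_tens hx hy) _.
exists (frac_tens f g); split=> //; case: h => [Cs [u [e1 e2]]].
case: h' => [Cs' [u' [e1' e2']]]; split; first exact: Ciso_tens.
by exists (u ⊠ u'); rewrite /= -!tensm_comp e1 e1' e2 e2'.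
Qed.

Lemma srep_Tl (M N P : A) (x : qhom M N) (f : Mor N P) Q (s : Mor Q M)
    (t : Mor Q N) : srep x s t -> srep (qcomp (qT f) x) s (f ∘ t).
Proof.
move=> h.
have := @srep_comp _ _ _ _ _ _ _ _ _ _ _ _ _ _ _ Q (idm Q) t h (srep_T hA C f).
by rewrite !hcompm1 hcomp1m; apply=> //; apply: srep_Ciso h.
Qed.

Lemma srep_Tr (M N P : A) (x : qhom N P) (f : Mor M N) Q (s : Mor Q N)
    (t : Mor Q P) R (v : Mor R M) (w : Mor R Q) :
  srep x s t -> Ciso v -> f ∘ v = s ∘ w ->
  srep (qcomp x (qT f)) v (t ∘ w).
Proof.
move=> h Cv e.
have := @srep_comp _ _ _ _ _ _ _ _ _ _ _ _ _ _ _ R v w (srep_T hA C f) h.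
by rewrite !hcomp1m; apply.
Qed.

Lemma qT_comp (X Y Z : A) (g : Mor Y Z) (f : Mor X Y) :
  qT (g ∘ f) = qcomp (qT g) (qT f).
Proof. by apply: srep_uniq (srep_T _ _ _) (srep_Tl _ (srep_T _ _ _)). Qed.

Lemma qT_linear (X Y : A) a (f g : Mor X Y) :
  qT (a *: f + g) = (a *: qT f + qT g)%R.
Proof.
apply: srep_uniq (srep_T _ _ _) _.
by apply: srep_add; [apply: srep_scale|]; apply: srep_T.
Qed.

Lemma qtens_T (M N X Y : A) (f : Mor M N) (g : Mor X Y) :
  qtens (qT f) (qT g) = qT (f ⊠ g).
Proof.
have := srep_tens (srep_T hA C f) (srep_T hA C g); rewrite tensm_id => h.
exact: srep_uniq h (srep_T _ _ _).
Qed.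

Definition quotient_cat : linCat K := quotient_lin hA C.

Definition quotient_functor : linFunctor A quotient_cat :=
  @LinFunctor K A quotient_cat (fun X => X) (fun X Y f => qT f)
    (fun X => erefl) qT_comp qT_linear.

Lemma qT_iso_l (X Y : A) (f : iso X Y) :
  (qT (ibwd f) : Mor (Y : quotient_cat) X) ∘ qT f = idm (X : quotient_cat).
Proof. by rewrite /= -qT_comp ifwdK. Qed.

Lemma qT_iso_r (X Y : A) (f : iso X Y) :
  (qT f : Mor (X : quotient_cat) Y) ∘ qT (ibwd f) = idm (Y : quotient_cat).
Proof. by rewrite /= -qT_comp ibwdK. Qed.

Definition qT_iso (X Y : A) (f : iso X Y) :
  iso (X : quotient_cat) (Y : quotient_cat) := Iso (qT_iso_l f) (qT_iso_r f).

Definition quotient_mon : monCat K.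
Proof.
refine (@MonCat K quotient_cat (fun X Y => X ⊗ Y)
  (fun X X' Y Y' f g => qtens f g) (munit A)
  (fun X Y Z => qT_iso (massoc X Y Z)) (fun X => qT_iso (mlunit X))
  (fun X => qT_iso (mrunit X)) _ _ _ _ _ _ _).
- by move=> X Y; rewrite /= qtens_T tensm_id.
- move=> X X' X'' Y Y' Y'' g f g' f' /=.
  have [Q1 [s1 [t1 h1]]] := srep_ex f; have [Q2 [s2 [t2 h2]]] := srep_ex g.
  have [Q1' [s1' [t1' h1']]] := srep_ex f'.
  have [Q2' [s2' [t2' h2']]] := srep_ex g'.
  have [P [v [w [pb Cv]]]] := ore_pullback hA t1 (srep_Ciso h2).
  have [P' [v' [w' [pb' Cv']]]] := ore_pullback hA t1' (srep_Ciso h2').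
  have C1 : Ciso (s1 ∘ v) by apply: Ciso_comp => //; apply: srep_Ciso h1.
  have C1' : Ciso (s1' ∘ v') by apply: Ciso_comp => //; apply: srep_Ciso h1'.
  have e := srep_comp h1 h2 (esym (proj1 pb)) C1.
  have e' := srep_comp h1' h2' (esym (proj1 pb')) C1'.
  apply: srep_uniq (srep_tens e e') _; rewrite !tensm_comp.
  apply: srep_comp (srep_tens h1 h1') (srep_tens h2 h2') _ _.
    by rewrite -!tensm_comp (proj1 pb) (proj1 pb').
  by rewrite -tensm_comp; apply: Ciso_tens.
- move=> X X' Y Y' Z Z' f g h /=.
  have [Q1 [s1 [t1 h1]]] := srep_ex f; have [Q2 [s2 [t2 h2]]] := srep_ex g.
  have [Q3 [s3 [t3 h3]]] := srep_ex h.
  have e1 := srep_tens (srep_tens h1 h2) h3.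
  have e2 := srep_tens h1 (srep_tens h2 h3).
  apply: srep_uniq (srep_Tl _ e1) _; rewrite massoc_nat.
  by apply: srep_Tr e2 (srep_Ciso e1) _; rewrite massoc_nat.
- move=> X Y f /=; have [Q [s [t h]]] := srep_ex f.
  have e := srep_tens (srep_T hA C (idm (munit A))) h.
  apply: srep_uniq (srep_Tl _ e) _; rewrite mlunit_nat.
  by apply: srep_Tr h (srep_Ciso e) _; rewrite mlunit_nat.
- move=> X Y f /=; have [Q [s [t h]]] := srep_ex f.
  have e := srep_tens h (srep_T hA C (idm (munit A))).
  apply: srep_uniq (srep_Tl _ e) _; rewrite mrunit_nat.
  by apply: srep_Tr h (srep_Ciso e) _; rewrite mrunit_nat.
- by move=> W X Y Z; rewrite /= !qtens_T -!qT_comp mpentagon.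
by move=> X Y; rewrite /= !qtens_T -!qT_comp mtriangle.
Defined.

End MonoidalQuotient.

(* Main.v *)
Require Import Defs.
From HB Require Import structures.
From mathcomp Require Import all_boot all_algebra.
From mathcomp Require Import boolp.

Set Implicit Arguments.
Unset Strict Implicit.
Unset Printing Implicit Defensive.

Import GRing.Theory.
Local Open Scope ring_scope.
Local Open Scope cat_scope.

(** An endomorphism [f] of the unit acts on every object [X] from the left, by
    [lact f X : X → 1 ⊗ X → 1 ⊗ X → X], and from the right, by [ract f X].
    Both actions are natural in [X] and turn the idempotents
    [p i = inj i ∘ prj i] into orthogonal projections of [X]; the component
    [A_ij] consists of the objects on which [p i] acts as the identity from the
    left and [p j] from the right ([component_act]).  Hence [⊕_(i, j ∈ P) A_ij]
    consists of the objects on which [∑_(i ∈ P) p i] acts as the identity from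
    both sides ([sum_component_act]).

    Duals enter twice.  First, every subobject of [1] is a direct summand
    ([unit_sub_split]), so that the [1_i], being images of primitive
    idempotents, are simple ([unit_summand_simple]).  Secondly, let [X ∈ C] and
    [1_i ∉ C].  The composite [1_i → 1 → X ⊗ X*] goes from a simple object
    outside [C] to an object of [C], so it vanishes, and the zigzag identity
    then says that [p i] acts as zero on [X] from the left; with the evaluation
    in place of the coevaluation it acts as zero from the right
    ([ideal_lact0], [ideal_ract0]).  Put [e = ∑_(i ∉ J) p i].  Objects of
    [C] are thus those killed by [e], that is [C = ⊕_(i, j ∈ J) A_ij].  All
    mixed components [A_ij], with exactly one of [i], [j] in [J], lie in [C]
    because [C] is an ideal, hence vanish, so [e] acts in the same way from
    both sides ([lact_ract_part]) and [D = ⊕_(i, j ∉ J) A_ij] consists of the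
    objects fixed by [e].

    By naturality of the action of [e] there are no nonzero morphisms between
    [C] and [D] in either direction.  A morphism whose kernel and cokernel are
    in [C] is therefore invertible as soon as it connects two objects of [D],
    which makes [T] fully faithful on [D].  If [U] is the image of [e], then
    [U ⊗ X ∈ D] and [U ⊗ X → X] becomes invertible in the quotient, so [T] is
    also essentially surjective on [D].  The unit part follows in the same way:
    [End_(A/C)(1)] is the corner of [End(1)] cut out by [e], and its primitive
    idempotents are those of [End(1)] that lie in this corner. *)

(** * Linear categories *)

Section Linear.
Variables (K : fieldType) (A : linCat K).
Implicit Types X Y Z : A.

Lemma hcomp_suml (I : finType) (P : pred I) X Y Z (g : I -> Mor Y Z)
    (f : Mor X Y) : (\sum_(i | P i) g i) ∘ f = \sum_(i | P i) g i ∘ f.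
Proof.
by apply: (big_morph (fun h => h ∘ f)) => [u v|]; rewrite ?hcompDl ?hcomp0m.
Qed.

Lemma hcomp_sumr (I : finType) (P : pred I) X Y Z (g : Mor Y Z)
    (f : I -> Mor X Y) : g ∘ (\sum_(i | P i) f i) = \sum_(i | P i) g ∘ f i.
Proof.
by apply: (big_morph (hcomp g)) => [u v|]; rewrite ?hcompDr ?hcompm0.
Qed.

Lemma mono_split X Y (f : Mor X Y) (r : Mor Y X) : r ∘ f = idm X -> mono f.
Proof.
by move=> rf; apply: (@mono_fac _ _ _ _ _ r); rewrite rf; apply: mono_id.
Qed.

Lemma epi_split X Y (f : Mor X Y) (r : Mor Y X) : f ∘ r = idm Y -> epi f.
Proof.
by move=> rf; apply: (@epi_fac _ _ _ _ _ f r); rewrite rf; apply: epi_id.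
Qed.

Lemma iso_mono X Y (f : Mor X Y) : is_iso f -> mono f.
Proof. by case=> g [gf _]; apply: mono_split gf. Qed.

Lemma iso_epi X Y (f : Mor X Y) : is_iso f -> epi f.
Proof. by case=> g [_ fg]; apply: epi_split fg. Qed.

Lemma iso_is_iso X Y (f : iso X Y) : is_iso f.
Proof. by exists (ibwd f); rewrite ifwdK ibwdK. Qed.

Lemma ibwd_is_iso X Y (f : iso X Y) : is_iso (ibwd f).
Proof. by exists f; rewrite ifwdK ibwdK. Qed.

Lemma is_iso_id X : is_iso (idm X).
Proof. by exists (idm X); rewrite hcomp1m. Qed.

Lemma is_iso_comp X Y Z (g : Mor Y Z) (f : Mor X Y) :
  is_iso g -> is_iso f -> is_iso (g ∘ f).
Proof.
move=> [g' [g'g gg']] [f' [f'f ff']]; exists (f' ∘ g'); split.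
  by rewrite -hcompA (hcompA g') g'g hcomp1m.
by rewrite -hcompA (hcompA f) ff' hcomp1m.
Qed.

Lemma isomorphic_sym X Y : isomorphic X Y -> isomorphic Y X.
Proof. by move=> [f [g [gf fg]]]; exists g, f. Qed.

Lemma isomorphic_trans Y X Z :
  isomorphic X Y -> isomorphic Y Z -> isomorphic X Z.
Proof. by move=> [f fi] [g gi]; exists (g ∘ f); apply: is_iso_comp. Qed.

Lemma serre_iso (C : serre A) X Y : isomorphic X Y -> C Y -> C X.
Proof. by move=> [f /iso_mono mf]; apply: serre_sub mf. Qed.

Lemma mono_eq0_zero X Y (f : Mor X Y) : mono f -> f = 0 -> is_zero X.
Proof. by move=> mf f0; apply: (mono0 mf); rewrite hcompm1. Qed.

Lemma epi_eq0_zero X Y (f : Mor X Y) : epi f -> f = 0 -> is_zero Y.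
Proof. by move=> ef f0; apply: (epi0 ef); rewrite hcomp1m. Qed.

End Linear.

(** * Recognising equivalences *)

Section Equivalences.
Variables (K : fieldType) (A B : linCat K) (F : linFunctor A B).

Lemma fmap0 X Y : fmap F (0 : Mor X Y) = 0.
Proof.
have := fmap_linear F (-1) (0 : Mor X Y) 0.
by rewrite scaler0 addr0 scaleN1r addNr.
Qed.

Lemma fmapD X Y (f g : Mor X Y) : fmap F (f + g) = fmap F f + fmap F g.
Proof. by have := fmap_linear F 1 f g; rewrite !scale1r. Qed.

Lemma fmapB X Y (f g : Mor X Y) : fmap F (f - g) = fmap F f - fmap F g.
Proof.
by rewrite addrC -scaleN1r fmap_linear scaleN1r addrC.
Qed.

Lemma fmap_sum (I : finType) (P : pred I) X Y (f : I -> Mor X Y) :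
  fmap F (\sum_(i | P i) f i) = \sum_(i | P i) fmap F (f i).
Proof.
by apply: (big_morph (@fmap _ _ _ F X Y)) => [u v|]; rewrite ?fmapD ?fmap0.
Qed.

Lemma fmap_is_iso X Y (f : Mor X Y) : is_iso f -> is_iso (fmap F f).
Proof.
by move=> [g [gf fg]]; exists (fmap F g); rewrite -!fmap_comp gf fg !fmap_id.
Qed.

Lemma is_equivalence_ff :
  (forall X Y (f : Mor X Y), fmap F f = 0 -> f = 0) ->
  (forall X Y (g : Mor (F X) (F Y)), exists f, fmap F f = g) ->
  (forall Y, exists X, isomorphic (F X) Y) -> is_equivalence F.
Proof.
move=> faithful full es.
have inj X Y : injective (@fmap _ _ _ F X Y).
  by move=> f g e; apply/subr0_eq/faithful; rewrite fmapB e subrr.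
(* An inverse functor is obtained by choosing, for each [Y], a preimage
   together with an isomorphism [th Y], and by lifting conjugated morphisms. *)
have h Y : exists p : {X : A & (Mor (F X) Y * Mor Y (F X))%type},
    (projT2 p).2 ∘ (projT2 p).1 = idm (F (projT1 p)) /\
    (projT2 p).1 ∘ (projT2 p).2 = idm Y.
  by have [X [f [g gf]]] := es Y; exists (existT _ X (f, g)).
pose p Y := projT1 (cid (h Y)); have pP Y := projT2 (cid (h Y)).
pose G0 Y := projT1 (p Y); pose th Y : Mor (F (G0 Y)) Y := (projT2 (p Y)).1.
pose th' Y : Mor Y (F (G0 Y)) := (projT2 (p Y)).2.
have th'K Y : th' Y ∘ th Y = idm (F (G0 Y)) by case: (pP Y).
have thK Y : th Y ∘ th' Y = idm Y by case: (pP Y).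
pose lift X Y (g : Mor (F X) (F Y)) : Mor X Y := projT1 (cid (full _ _ g)).
have liftK X Y (g : Mor (F X) (F Y)) : fmap F (lift X Y g) = g.
  exact: projT2 (cid (full _ _ g)).
pose G1 X Y (g : Mor X Y) : Mor (G0 X) (G0 Y) := lift _ _ (th' Y ∘ g ∘ th X).
have G1K X Y (g : Mor X Y) : th Y ∘ fmap F (G1 X Y g) = g ∘ th X.
  by rewrite liftK !hcompA thK hcomp1m.
have thmono Y : mono (th Y) by apply: mono_split (th'K Y).
have G_id X : G1 X X (idm X) = idm (G0 X).
  by apply: inj; apply: thmono; rewrite G1K fmap_id hcomp1m hcompm1.
have G_comp X Y Z (g : Mor Y Z) (f : Mor X Y) :
    G1 X Z (g ∘ f) = G1 Y Z g ∘ G1 X Y f.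
  by apply: inj; apply: thmono; rewrite G1K fmap_comp hcompA G1K -!hcompA G1K.
have G_lin X Y a (f g : Mor X Y) :
    G1 X Y (a *: f + g) = a *: G1 X Y f + G1 X Y g.
  apply: inj; apply: thmono; rewrite G1K fmap_linear hcompDr hcompZr !G1K.
  by rewrite hcompDl hcompZl.
exists (LinFunctor G_id G_comp G_lin); split; last first.
  exists th; split=> [Y|X Y f]; last exact: G1K.
  by exists (th' Y); split; [apply: th'K | apply: thK].
exists (fun X => lift _ _ (th (F X))); split=> [X|X Y f] /=; last first.
  by apply: inj; rewrite !fmap_comp !liftK !hcompA thK hcomp1m.
exists (lift _ _ (th' (F X))).
by split; apply: inj; rewrite fmap_comp !liftK fmap_id.
Qed.

Lemma is_equivalence_equivalent : is_equivalence F -> equivalent B A.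
Proof. by move=> [G [h1 h2]]; exists G, F. Qed.

End Equivalences.

(** * The action of the endomorphisms of the unit *)

Section UnitActions.
Variables (K : fieldType) (A : monCat K).
Implicit Types V W X Y Z : A.
Local Notation "1" := (munit A) : cat_scope.

Lemma tensm_lr X X' Y Y' (f : Mor X X') (g : Mor Y Y') :
  f ⊠ g = (f ⊠ idm Y') ∘ (idm X ⊠ g).
Proof. by rewrite -tensm_comp hcompm1 hcomp1m. Qed.

Lemma tensm_rl X X' Y Y' (f : Mor X X') (g : Mor Y Y') :
  f ⊠ g = (idm X' ⊠ g) ∘ (f ⊠ idm Y).
Proof. by rewrite -tensm_comp hcompm1 hcomp1m. Qed.

Lemma tensm_is_iso X X' Y Y' (f : Mor X X') (g : Mor Y Y') :
  is_iso f -> is_iso g -> is_iso (f ⊠ g).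
Proof.
move=> [f' [h1 h2]] [g' [h3 h4]]; exists (f' ⊠ g').
by rewrite -!tensm_comp h1 h2 h3 h4 !tensm_id.
Qed.

(** Tensoring with the unit is isomorphic to the identity functor, so it is
    faithful. *)
Lemma tens1m_inj X Y (f g : Mor X Y) : idm 1 ⊠ f = idm 1 ⊠ g -> f = g.
Proof.
move=> e; apply: (iso_epi (iso_is_iso (mlunit X))).
by rewrite -!mlunit_nat e.
Qed.

Lemma tensm1_inj X Y (f g : Mor X Y) : f ⊠ idm 1 = g ⊠ idm 1 -> f = g.
Proof.
move=> e; apply: (iso_epi (iso_is_iso (mrunit X))).
by rewrite -!mrunit_nat e.
Qed.

(** Kelly's coherence: after tensoring with [1] on the left, this follows from
    the pentagon for [1, 1, X, Y] and the triangle. *)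
Lemma mlunit_tens X Y :
  mlunit (X ⊗ Y) ∘ massoc 1 X Y = mlunit X ⊠ idm Y.
Proof.
apply: tens1m_inj.
have epi1 : epi (massoc 1 (1 ⊗ X) Y) by apply/iso_epi/iso_is_iso.
have epi2 : epi (massoc 1 1 X ⊠ idm Y).
  by apply/iso_epi/tensm_is_iso; [apply: iso_is_iso | apply: is_iso_id].
apply: epi1; apply: epi2.
rewrite -(massoc_nat (idm 1) (mlunit X) (idm Y)) -[RHS]hcompA -tensm_comp.
rewrite mtriangle hcompm1 massoc_nat tensm_id -mtriangle.
rewrite -(hcompA _ (massoc 1 1 (X ⊗ Y))) mpentagon !hcompA -tensm_comp.
by rewrite hcompm1.
Qed.

(** Both [mlunit 1 ⊠ 1] and [mrunit 1 ⊠ 1] are the composite of [1 ⊠ mlunit 1]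
    with the associator, by Kelly's identity and the triangle respectively. *)
Lemma mlunit1 : mlunit 1 = mrunit 1 :> Mor (1 ⊗ 1) 1.
Proof.
apply: tensm1_inj; rewrite -mlunit_tens -mtriangle; congr (_ ∘ _).
by apply: (iso_mono (iso_is_iso (mlunit 1))); rewrite mlunit_nat.
Qed.

(** A summand [V] of the unit, with inclusion [f] and projection [g], gives for
    each [X] a summand [V ⊗ X] of [X] with inclusion [lin f X] and projection
    [lout g X]; [rin] and [rout] do the same for [X ⊗ V]. *)
Definition lin V (f : Mor V 1) X : Mor (V ⊗ X) X := mlunit X ∘ (f ⊠ idm X).
Definition lout V (g : Mor 1 V) X : Mor X (V ⊗ X) :=
  (g ⊠ idm X) ∘ ibwd (mlunit X).
Definition lact (f : Mor 1 1) X : Mor X X := lin f X ∘ ibwd (mlunit X).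

Definition rin V (f : Mor V 1) X : Mor (X ⊗ V) X := mrunit X ∘ (idm X ⊠ f).
Definition rout V (g : Mor 1 V) X : Mor X (X ⊗ V) :=
  (idm X ⊠ g) ∘ ibwd (mrunit X).
Definition ract (f : Mor 1 1) X : Mor X X := rin f X ∘ ibwd (mrunit X).

Lemma lin_nat V (f : Mor V 1) X Y (h : Mor X Y) :
  lin f Y ∘ (idm V ⊠ h) = h ∘ lin f X.
Proof.
by rewrite /lin -hcompA -tensm_lr tensm_rl hcompA mlunit_nat hcompA.
Qed.

Lemma rin_nat V (f : Mor V 1) X Y (h : Mor X Y) :
  rin f Y ∘ (h ⊠ idm V) = h ∘ rin f X.
Proof.
by rewrite /rin -hcompA -tensm_rl tensm_lr hcompA mrunit_nat hcompA.
Qed.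

Lemma ibwd_lunit_nat X Y (h : Mor X Y) :
  ibwd (mlunit Y) ∘ h = (idm 1 ⊠ h) ∘ ibwd (mlunit X).
Proof.
apply: (iso_mono (iso_is_iso (mlunit Y))).
by rewrite !hcompA ibwdK mlunit_nat -hcompA ibwdK hcomp1m hcompm1.
Qed.

Lemma ibwd_runit_nat X Y (h : Mor X Y) :
  ibwd (mrunit Y) ∘ h = (h ⊠ idm 1) ∘ ibwd (mrunit X).
Proof.
apply: (iso_mono (iso_is_iso (mrunit Y))).
by rewrite !hcompA ibwdK mrunit_nat -hcompA ibwdK hcomp1m hcompm1.
Qed.

Lemma rout_nat V (g : Mor 1 V) X Y (h : Mor X Y) :
  (h ⊠ idm V) ∘ rout g X = rout g Y ∘ h.
Proof.
by rewrite /rout hcompA -tensm_lr -hcompA ibwd_runit_nat hcompA -tensm_rl.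
Qed.

Lemma lact_nat f X Y (h : Mor X Y) : lact f Y ∘ h = h ∘ lact f X.
Proof.
by rewrite /lact -hcompA ibwd_lunit_nat hcompA lin_nat hcompA.
Qed.

Lemma ract_nat f X Y (h : Mor X Y) : ract f Y ∘ h = h ∘ ract f X.
Proof.
by rewrite /ract -hcompA ibwd_runit_nat hcompA rin_nat hcompA.
Qed.

Lemma lin_lout V (f : Mor V 1) (g : Mor 1 V) X :
  lin f X ∘ lout g X = lact (f ∘ g) X.
Proof.
by rewrite /lact /lin /lout hcompA -(hcompA _ (f ⊠ _)) -tensm_comp hcompm1.
Qed.

Lemma rin_rout V (f : Mor V 1) (g : Mor 1 V) X :
  rin f X ∘ rout g X = ract (f ∘ g) X.
Proof.
by rewrite /ract /rin /rout hcompA -(hcompA _ (_ ⊠ f)) -tensm_comp hcompm1.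
Qed.

Lemma lout_lin V W (f : Mor V 1) (g : Mor 1 W) X :
  lout g X ∘ lin f X = (g ∘ f) ⊠ idm X.
Proof.
rewrite /lin /lout hcompA -(hcompA _ (ibwd _)) ifwdK hcompm1 -tensm_comp.
by rewrite hcompm1.
Qed.

Lemma rout_rin V W (f : Mor V 1) (g : Mor 1 W) X :
  rout g X ∘ rin f X = idm X ⊠ (g ∘ f).
Proof.
rewrite /rin /rout hcompA -(hcompA _ (ibwd _)) ifwdK hcompm1 -tensm_comp.
by rewrite hcompm1.
Qed.

Lemma lact_comp f g X : lact (f ∘ g) X = lact f X ∘ lact g X.
Proof.
rewrite -{2}(hcompm1 f) -{2}(hcomp1m g) -!lin_lout -(hcompA (lin f X)).
by rewrite (hcompA (lout _ X)) lout_lin !hcomp1m tensm_id hcomp1m.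
Qed.

Lemma ract_comp f g X : ract (f ∘ g) X = ract f X ∘ ract g X.
Proof.
rewrite -{2}(hcompm1 f) -{2}(hcomp1m g) -!rin_rout -(hcompA (rin f X)).
by rewrite (hcompA (rout _ X)) rout_rin !hcomp1m tensm_id hcomp1m.
Qed.

Lemma lact1 X : lact (idm 1) X = idm X.
Proof. by rewrite /lact /lin tensm_id hcompm1 ibwdK. Qed.

Lemma ract1 X : ract (idm 1) X = idm X.
Proof. by rewrite /ract /rin tensm_id hcompm1 ibwdK. Qed.

Lemma lact_unit f : lact f 1 = f.
Proof.
by rewrite /lact /lin mlunit1 mrunit_nat -mlunit1 -hcompA ibwdK hcompm1.
Qed.

Lemma lact_lunit f X : lact f X ∘ mlunit X = lin f X.
Proof. by rewrite /lact -hcompA ifwdK hcompm1. Qed.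

Lemma ract_runit f X : ract f X ∘ mrunit X = rin f X.
Proof. by rewrite /ract -hcompA ifwdK hcompm1. Qed.

Lemma lin_assoc V (f : Mor V 1) X Y :
  lin f (X ⊗ Y) ∘ massoc V X Y = lin f X ⊠ idm Y.
Proof.
rewrite /lin -hcompA -tensm_id -massoc_nat hcompA mlunit_tens -tensm_comp.
by rewrite hcompm1.
Qed.

Lemma lact_tens f X Y : lact f (X ⊗ Y) = lact f X ⊠ idm Y.
Proof.
apply: (iso_epi (iso_is_iso (mlunit (X ⊗ Y)))).
apply: (iso_epi (iso_is_iso (massoc 1 X Y))).
rewrite lact_lunit lin_assoc -hcompA mlunit_tens -tensm_comp lact_lunit.
by rewrite hcompm1.
Qed.

Lemma lin_mono V (f : Mor V 1) (g : Mor 1 V) X :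
  g ∘ f = idm V -> mono (lin f X).
Proof.
by move=> gf; apply: (mono_split (r := lout g X)); rewrite lout_lin gf tensm_id.
Qed.

Lemma rin_mono V (f : Mor V 1) (g : Mor 1 V) X :
  g ∘ f = idm V -> mono (rin f X).
Proof.
by move=> gf; apply: (mono_split (r := rout g X)); rewrite rout_rin gf tensm_id.
Qed.

(** By naturality along the monomorphism [lin f X] it is enough to look at [X],
    on which [f ∘ g] acts as the projection onto the summand [V ⊗ X]. *)
Lemma lact_summand V (f : Mor V 1) (g : Mor 1 V) X : g ∘ f = idm V ->
  lact (f ∘ g) (V ⊗ X) = idm (V ⊗ X).
Proof.
move=> gf; apply: (lin_mono gf).
by rewrite -lact_nat -lin_lout -hcompA lout_lin gf tensm_id.
Qed.

Lemma ract_summand V (f : Mor V 1) (g : Mor 1 V) X : g ∘ f = idm V ->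
  ract (f ∘ g) (X ⊗ V) = idm (X ⊗ V).
Proof.
move=> gf; apply: (rin_mono gf).
by rewrite -ract_nat -rin_rout -hcompA rout_rin gf tensm_id.
Qed.

Lemma lact_iso f X Y : isomorphic X Y -> lact f Y = idm Y -> lact f X = idm X.
Proof.
move=> [h /iso_mono mh] e; apply: mh.
by rewrite -lact_nat e hcomp1m hcompm1.
Qed.

Lemma ract_iso f X Y : isomorphic X Y -> ract f Y = idm Y -> ract f X = idm X.
Proof.
move=> [h /iso_mono mh] e; apply: mh.
by rewrite -ract_nat e hcomp1m hcompm1.
Qed.

End UnitActions.

(** * Subobjects of the unit object *)

Section TensorExact.
Variables (K : fieldType) (A : multiringCat K).
Let hA := mr_abelian A.
Implicit Types V W X Y Z : A.

Lemma tensmDl X X' Y Y' (f f' : Mor X X') (g : Mor Y Y') :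
  (f + f') ⊠ g = f ⊠ g + f' ⊠ g.
Proof. by have := mr_linl 1 f f' g; rewrite !scale1r. Qed.

Lemma tensmDr X X' Y Y' (f : Mor X X') (g g' : Mor Y Y') :
  f ⊠ (g + g') = f ⊠ g + f ⊠ g'.
Proof. by have := mr_linr 1 f g g'; rewrite !scale1r. Qed.

Lemma tensm0l X X' Y Y' (g : Mor Y Y') : (0 : Mor X X') ⊠ g = 0.
Proof. by apply: (@addrI _ (0 ⊠ g)); rewrite -tensmDl !addr0. Qed.

Lemma tensm0r X X' Y Y' (f : Mor X X') : f ⊠ (0 : Mor Y Y') = 0.
Proof. by apply: (@addrI _ (f ⊠ 0)); rewrite -tensmDr !addr0. Qed.

Lemma lactD (f g : Mor (munit A) (munit A)) X :
  lact (f + g) X = lact f X + lact g X.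
Proof. by rewrite /lact /lin tensmDl hcompDr hcompDl. Qed.

Lemma ractD (f g : Mor (munit A) (munit A)) X :
  ract (f + g) X = ract f X + ract g X.
Proof. by rewrite /ract /rin tensmDr hcompDr hcompDl. Qed.

Lemma lact0 X : lact (0 : Mor (munit A) _) X = 0.
Proof. by rewrite /lact /lin tensm0l hcompm0 hcomp0m. Qed.

Lemma ract0 X : ract (0 : Mor (munit A) _) X = 0.
Proof. by rewrite /ract /rin tensm0r hcompm0 hcomp0m. Qed.

Lemma lact_sum (I : finType) (P : pred I) (f : I -> Mor (munit A) (munit A)) X :
  lact (\sum_(i | P i) f i) X = \sum_(i | P i) lact (f i) X.
Proof.
by apply: (big_morph (fun h => lact h X)) => [u v|]; rewrite ?lactD ?lact0.
Qed.

Lemma ract_sum (I : finType) (P : pred I) (f : I -> Mor (munit A) (munit A)) X :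
  ract (\sum_(i | P i) f i) X = \sum_(i | P i) ract (f i) X.
Proof.
by apply: (big_morph (fun h => ract h X)) => [u v|]; rewrite ?ractD ?ract0.
Qed.

Lemma tensr_mono W X Y (f : Mor X Y) : mono f -> mono (f ⊠ idm W).
Proof.
move=> mf; have [Q [c hc]] := ab_cokernel hA f.
exact: kernel_mono (proj1 (mr_exactr W (conj (mono_kernel hA mf hc) hc))).
Qed.

Section UnitSubobject.
Hypothesis A_dual : has_left_duals A.

(** Let [Y = 1/X], let [d : 1 → X*] be the dual of [m] and [N = ker d].  The
    map [d] is epi, because precomposition with it corresponds by adjunction to
    [X ⊗ Z → Z], which is mono.  Since [d] factors through [X ⊗ X* → X*], the
    latter is epi too, and therefore [Y ⊗ X* = 0].  Since [N] is killed by the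
    coevaluation, which becomes split mono after tensoring with [X], also
    [N ⊗ X = 0].  Exactness now makes [N ⊗ 1 → N ⊗ Y] mono and [Y ⊗ N → Y ⊗ 1]
    epi.  Up to unit isomorphisms, [N → 1 → Y] is the tensor product of
    [N → 1] and [1 → Y] in either order; one order is mono and the other is epi,
    so [N → Y] is an isomorphism and [1 = X ⊕ N]. *)
Lemma unit_sub_split X (m : Mor X (munit A)) : mono m ->
  exists r : Mor (munit A) X, r ∘ m = idm X.
Proof.
move=> mm; have [X' [ev [coev [zig zag]]]] := A_dual X.
have [Y [c hc]] := ab_cokernel hA m.
have km := mono_kernel hA mm hc.
pose d : Mor (munit A) X' := lin m X' ∘ coev.
have mX' : mono (lin m X').
  apply: mono_comp; first exact/iso_mono/iso_is_iso.
  exact: tensr_mono.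
(* If [g ∘ d = 0], then [(X ⊠ g) ∘ coev = 0] because [lin m Z] is mono, and
   the second zigzag identity expresses [g] by this composite. *)
have ed : epi d.
  apply: epiP => Z g; rewrite /d hcompA -lin_nat -hcompA => gd.
  have mZ : mono (lin m Z).
    apply: mono_comp; first exact/iso_mono/iso_is_iso.
    exact: tensr_mono.
  have gc := mono0 mZ gd.
  rewrite -(hcompm1 g) -zag !hcompA -mlunit_nat.
  rewrite -(hcompA _ (_ ⊠ g)) -tensm_rl tensm_lr -(tensm_id X' X).
  have -> : (idm X' ⊠ idm X) ⊠ g =
    ibwd (massoc X' X Z) ∘ (idm X' ⊠ (idm X ⊠ g)) ∘ massoc X' X X'.
    by rewrite -hcompA -massoc_nat hcompA ifwdK hcomp1m.
  rewrite -!hcompA (hcompA (massoc X' X X')) ibwdK hcomp1m.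
  rewrite (hcompA (_ ⊠ _) (_ ⊠ coev)) -tensm_comp gc tensm0r.
  by rewrite hcomp0m !hcompm0.
(* [Y ⊗ X'] is the cokernel of [m ⊠ X'], which is epi as [d] factors through
   it. *)
have zYX' : is_zero (Y ⊗ X').
  have /cokernel_epi ec := proj2 (mr_exactr X' (conj km hc)).
  apply: (epi_eq0_zero ec); apply: (epi0 (f := m ⊠ idm X')).
    apply: epiP => Z g gm.
    have eml : epi (lin m X') by apply: epi_fac ed.
    have h0 : (g ∘ ibwd (mlunit X')) ∘ lin m X' = 0.
      by rewrite /lin hcompA -(hcompA g) ifwdK hcompm1.
    have := epi0 eml h0 => h1.
    by rewrite -(hcompm1 g) -(ifwdK (mlunit X')) hcompA h1 hcomp0m.
  by rewrite -tensm_comp (proj1 hc) tensm0l.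
have [N [n hn]] := ab_kernel hA d.
have mn := kernel_mono hn.
have cn0 : coev ∘ n = 0.
  by apply: (mono0 mX'); rewrite hcompA; case: hn.
have zNX : is_zero (N ⊗ X).
  (* By the first zigzag identity [coev ⊠ X] is the first factor of the
     isomorphism [mlunit X]. *)
  have mcX : mono (coev ⊠ idm X).
    apply: (@mono_fac _ _ _ _ _ (mrunit X ∘ (idm X ⊠ ev) ∘ massoc X X' X)).
    have -> : mrunit X ∘ (idm X ⊠ ev) ∘ massoc X X' X ∘ (coev ⊠ idm X) =
        mlunit X :> Mor _ X.
      by apply: (iso_epi (ibwd_is_iso (mlunit X))); rewrite zig ibwdK.
    exact/iso_mono/iso_is_iso.
  have mnX := tensr_mono (W := X) mn.
  apply: (mono_eq0_zero mnX); apply: (mono0 mcX).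
  by rewrite -tensm_comp cn0 tensm0l.
have mcn : mono (c ∘ n).
  have mNc : mono (idm N ⊠ c).
    apply: monoP => W w Nw.
    have [h <-] := kernel_fac (proj1 (mr_exactl N (conj km hc))) Nw.
    by rewrite (hom_zero h zNX) hcompm0.
  have := mono_comp (tensr_mono (W := Y) mn) mNc.
  rewrite -tensm_lr tensm_rl => mnc.
  have -> : c ∘ n = mlunit Y ∘ ((idm _ ⊠ c) ∘ (n ⊠ idm _)) ∘ ibwd (mrunit N).
    rewrite hcompA mlunit_nat mlunit1 -2!hcompA (hcompA (mrunit _)) mrunit_nat.
    by rewrite -hcompA ibwdK hcompm1.
  apply: mono_comp; last exact/iso_mono/ibwd_is_iso.
  by apply: mono_comp mnc; apply/iso_mono/iso_is_iso.
have ecn : epi (c ∘ n).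
  have eYn : epi (idm Y ⊠ n).
    apply: epiP => W w Yw.
    have hd := epi_cokernel hA ed hn.
    have [h <-] := cokernel_fac (proj2 (mr_exactl Y (conj hn hd))) Yw.
    by rewrite (zero_hom h zYX') hcomp0m.
  have ecN : epi (c ⊠ idm N).
    exact: cokernel_epi (proj2 (mr_exactr N (conj km hc))).
  have := epi_comp eYn ecN; rewrite -tensm_rl tensm_lr => ecn.
  have -> : c ∘ n = mrunit Y ∘ ((c ⊠ idm _) ∘ (idm _ ⊠ n)) ∘ ibwd (mlunit N).
    rewrite hcompA mrunit_nat -mlunit1 -2!hcompA (hcompA (mlunit _)) mlunit_nat.
    by rewrite -hcompA ibwdK hcompm1.
  apply: epi_comp; last exact/iso_epi/ibwd_is_iso.
  by apply: epi_comp ecn; apply/iso_epi/iso_is_iso.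
have [w [wcn cnw]] := mono_epi_iso hA mcn ecn.
(* [1 - n (c n)^-1 c] is killed by [c], so it factors through [m]. *)
have [r er] : exists r, m ∘ r = idm _ - n ∘ w ∘ c.
  apply: (kernel_fac km).
  by rewrite hcompBr hcompm1 !hcompA cnw hcomp1m subrr.
exists r; apply: mm.
by rewrite hcompA er hcompBl hcomp1m -!hcompA (proj1 hc) !hcompm0 subr0 hcompm1.
Qed.

End UnitSubobject.
End TensorExact.

(** * Components *)

Lemma sum_sig (I : finType) (V : nmodType) (P : pred I) (F : I -> V) :
  \sum_(s : {i | P i}) F (val s) = \sum_(i | P i) F i.
Proof. exact: (esym (big_sub P F)). Qed.

Section UnitDecomposition.
Variables (K : fieldType) (A : multiringCat K) (I : finType) (one : I -> A).
Variables (inj : forall i, Mor (one i) (munit A)).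
Variables (prj : forall i, Mor (munit A) (one i)).
Let hA := mr_abelian A.
Local Notation p i := (inj i ∘ prj i).

Section Biproduct.
Hypothesis bip : is_biproduct inj prj.

Lemma prj_inj i : prj i ∘ inj i = idm (one i).
Proof. by case: bip. Qed.

Lemma prj_inj_neq i j : i != j -> prj j ∘ inj i = 0.
Proof. by case: bip => _ h _; apply: h. Qed.

Lemma unit_idem_mul i j : p i ∘ p j = if i == j then p i else 0.
Proof.
rewrite hcompA -(hcompA (inj i)); case: eqP => [<-|/eqP ij].
  by rewrite prj_inj hcompm1.
by rewrite prj_inj_neq 1?eq_sym // hcompm0 hcomp0m.
Qed.

Definition unit_part (P : pred I) : Mor (munit A) (munit A) :=
  \sum_(i | P i) p i.

Lemma unit_partC (P : pred I) :
  unit_part P + unit_part (fun i => ~~ P i) = idm (munit A).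
Proof. by case: bip => _ _ <-; rewrite [RHS](bigID P). Qed.

Lemma unit_part_summand (P : pred I) U
    (injU : forall i : {i | P i}, Mor (one (val i)) U)
    (prjU : forall i : {i | P i}, Mor U (one (val i))) :
  is_biproduct injU prjU ->
  (\sum_i injU i ∘ prj (val i)) ∘ (\sum_i inj (val i) ∘ prjU i) = idm U /\
  (\sum_i inj (val i) ∘ prjU i) ∘ (\sum_i injU i ∘ prj (val i)) = unit_part P.
Proof.
move=> [u1 u2 u3].
rewrite -u3 /unit_part -(sum_sig P (fun i => p i)) !hcomp_suml.
split; apply: eq_bigr => i _; rewrite hcomp_sumr (bigD1 i) //= big1 ?addr0.
- by rewrite hcompA -(hcompA (injU i)) prj_inj hcompm1.
- move=> j ji; rewrite hcompA -(hcompA (injU i)) prj_inj_neq //.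
  by rewrite hcompm0 hcomp0m.
- by rewrite hcompA -(hcompA (inj _)) u1 hcompm1.
move=> j ji; rewrite hcompA -(hcompA (inj _)) u2 //.
by rewrite hcompm0 hcomp0m.
Qed.

Lemma unit_part_idem (P : pred I) i :
  unit_part P ∘ p i = if P i then p i else 0.
Proof.
rewrite hcomp_suml; case: (boolP (P i)) => Pi.
  rewrite (bigD1 i) //= unit_idem_mul eqxx big1 ?addr0 // => j /andP[_ ji].
  by rewrite unit_idem_mul (negPf ji).
rewrite big1 // => j Pj; rewrite unit_idem_mul; case: eqP => // ji.
by rewrite -ji Pj in Pi.
Qed.

(** If [p i] and [p j] act as identities on [X], then [X] is isomorphic to its
    summand [1_i ⊗ X ⊗ 1_j]. *)
Lemma component_act i j X : component one i j X <->
  lact (p i) X = idm X /\ ract (p j) X = idm X.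
Proof.
split=> [[Y e]|[li rj]].
  split; last by apply: ract_iso e _; apply/ract_summand/prj_inj.
  apply: lact_iso e _; rewrite lact_tens lact_summand ?prj_inj //.
  by rewrite tensm_id.
exists X; apply: (@isomorphic_trans _ _ (one i ⊗ X)).
  exists (lout (prj i) X), (lin (inj i) X).
  by rewrite lin_lout lout_lin prj_inj tensm_id.
have rj' : ract (p j) (one i ⊗ X) = idm (one i ⊗ X).
  apply: ract_iso rj; exists (lin (inj i) X), (lout (prj i) X).
  by rewrite lin_lout lout_lin prj_inj tensm_id.
exists (rout (prj j) _), (rin (inj j) _).
by rewrite rin_rout rout_rin prj_inj tensm_id.
Qed.

(** The summands of an object fixed by [unit_part P] on both sides are taken to
    be the [1_i ⊗ X ⊗ 1_j] with [i], [j] in [P]. *)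
Lemma sum_component_act (P : pred I) X :
  sum_subcat (fun q : {i | P i} * {i | P i} =>
    component one (val q.1) (val q.2)) X <->
  lact (unit_part P) X = idm X /\ ract (unit_part P) X = idm X.
Proof.
have part_l i Y : P i -> lact (p i) Y = idm Y -> lact (unit_part P) Y = idm Y.
  by move=> Pi e; rewrite -[LHS]hcompm1 -e -lact_comp unit_part_idem Pi.
have part_r i Y : P i -> ract (p i) Y = idm Y -> ract (unit_part P) Y = idm Y.
  by move=> Pi e; rewrite -[LHS]hcompm1 -e -ract_comp unit_part_idem Pi.
split=> [[Y [iq [pq [Yc [b1 b2 b3]]]]]|[lX rX]].
  rewrite -b3; split.
    rewrite -[LHS]hcompm1 -b3 hcomp_sumr; apply: eq_bigr => q _.
    have [lq _] := (component_act _ _ _).1 (Yc q).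
    by rewrite hcompA lact_nat (part_l _ _ (valP q.1) lq) hcompm1.
  rewrite -[LHS]hcompm1 -b3 hcomp_sumr; apply: eq_bigr => q _.
  have [_ rq] := (component_act _ _ _).1 (Yc q).
  by rewrite hcompA ract_nat (part_r _ _ (valP q.2) rq) hcompm1.
exists (fun q => one (val q.1) ⊗ X ⊗ one (val q.2)).
exists (fun q => lin (inj (val q.1)) X ∘ rin (inj (val q.2)) _).
exists (fun q => rout (prj (val q.2)) _ ∘ lout (prj (val q.1)) X).
split; first by move=> q; exists X, (idm _); apply: is_iso_id.
split=> [q|q q' qq'|].
- rewrite hcompA -(hcompA _ (lout _ _)) lout_lin prj_inj tensm_id hcompm1.
  by rewrite rout_rin prj_inj tensm_id.
- rewrite hcompA -(hcompA _ (lout _ _)) lout_lin.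
  case: (eqVneq (val q.1) (val q'.1)) => [e1|ne1]; last first.
    by rewrite prj_inj_neq // tensm0l hcompm0 hcomp0m.
  have ne2 : val q.2 != val q'.2.
    apply: contraNneq qq' => e2; apply/eqP.
    by case: q q' e1 e2 => [? ?] [? ?] /= /val_inj -> /val_inj ->.
  rewrite -(rout_nat _ ((prj _ ∘ _) ⊠ _)) -hcompA rout_rin (prj_inj_neq ne2).
  by rewrite tensm0r hcompm0.
rewrite -(pair_big xpredT xpredT (fun s t : {i | P i} =>
   lin (inj (val s)) X ∘ rin (inj (val t)) _ ∘
   (rout (prj (val t)) _ ∘ lout (prj (val s)) X))) /=.
transitivity (\sum_(s : {i | P i}) lact (p (val s)) X).
  apply: eq_bigr => s _.
  transitivity (\sum_(t : {i | P i}) lact (p (val s)) X ∘ ract (p (val t)) X).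
    apply: eq_bigr => t _.
    rewrite hcompA -(hcompA _ (rin _ _)) rin_rout -hcompA ract_nat hcompA.
    by rewrite lin_lout.
  rewrite (sum_sig P (fun t => lact _ X ∘ ract (p t) X)) -hcomp_sumr.
  by rewrite -ract_sum rX hcompm1.
by rewrite (sum_sig P (fun t => lact (p t) X)) -lact_sum.
Qed.

End Biproduct.

(** A subobject of [1_i] is a subobject of [1], hence split; the idempotent
    projecting onto it would decompose the primitive idempotent [p i] if the
    subobject were neither zero nor all of [1_i]. *)
Lemma unit_summand_simple i : has_left_duals A -> unit_decomposition inj prj ->
  simple_obj (one i).
Proof.
move=> A_dual [bip _ prim].
have [p0 _ pmin] := (prim (p i)).2 (ex_intro _ i erefl).
split=> [z|X m mm].
  by apply: p0; rewrite (zero_hom (inj i) z) hcomp0m.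
have minj : mono (inj i) by apply: mono_split (prj_inj bip i).
have [r rm] := unit_sub_split A_dual (mono_comp minj mm).
have {r rm} [r rm] : exists r, r ∘ m = idm X.
  by exists (r ∘ inj i); rewrite -hcompA.
pose e := m ∘ r; have ee : e ∘ e = e.
  by rewrite /e hcompA -(hcompA m) rm hcompm1.
have conj_mul (a b : Mor (one i) (one i)) :
    (inj i ∘ a ∘ prj i) ∘ (inj i ∘ b ∘ prj i) = inj i ∘ (a ∘ b) ∘ prj i.
  by rewrite !hcompA -(hcompA (inj i ∘ a)) prj_inj // hcompm1.
have conj0 (a : Mor (one i) (one i)) : inj i ∘ a ∘ prj i = 0 -> a = 0.
  move=> h; rewrite -(hcompm1 a) -(hcomp1m a) -(prj_inj bip) -!hcompA.
  by rewrite (hcompA (inj i)) (hcompA _ (prj i)) h hcomp0m hcompm0.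
have ne : (idm _ - e) ∘ e = 0 by rewrite hcompBl hcomp1m ee subrr.
have en : e ∘ (idm _ - e) = 0 by rewrite hcompBr hcompm1 ee subrr.
have [|||||/conj0 e0|/conj0 e1] :=
  pmin (inj i ∘ e ∘ prj i) (inj i ∘ (idm _ - e) ∘ prj i).
- by rewrite conj_mul ee.
- by rewrite conj_mul hcompBr hcompm1 ne subr0.
- by rewrite conj_mul en hcompm0 hcomp0m.
- by rewrite conj_mul ne hcompm0 hcomp0m.
- by rewrite -hcompDl -hcompDr addrC subrK hcompm1.
- left; rewrite /is_zero -(hcompm1 (idm X)) -rm -!hcompA (hcompA m).
  by rewrite -/e e0 hcomp0m hcompm0.
by right; exists r; split=> //; rewrite -/e; apply/esym/subr0_eq.
Qed.

End UnitDecomposition.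

(** * Simple objects and Serre subcategories *)

Section SerreSubcategories.
Variables (K : fieldType) (A : linCat K) (hA : abelian_cat A) (C : serre A).

Lemma simple_serre_out S X (f : Mor S X) :
  simple_obj S -> C X -> ~ C S -> f = 0.
Proof.
move=> [_ sim] CX nCS; have [N [k hk]] := ab_kernel hA f.
have [z|ik] := sim _ k (kernel_mono hk); last first.
  by apply: (epi0 (iso_epi ik)); case: hk.
case: nCS; apply: (serre_sub (m := f)) CX; apply: monoP => W g fg.
by have [h <-] := kernel_fac hk fg; rewrite (hom_zero h z) hcompm0.
Qed.

Lemma simple_serre_in S X (f : Mor X S) :
  simple_obj S -> C X -> ~ C S -> f = 0.
Proof.
move=> [_ sim] CX nCS; have [Y [e [m [ee mm fme]]]] := image_ex hA f.
have [z|im] := sim _ m mm; first by rewrite fme (zero_hom m z) hcomp0m.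
case: nCS; apply: (serre_quo (q := f)) CX; rewrite fme.
by apply: epi_comp ee; apply: iso_epi.
Qed.

(** Morphisms with kernel and cokernel in [C] become invertible in the
    quotient, so they may be cancelled there. *)
Lemma Ciso_T_eq X Y Z (s : Mor X Y) (f g : Mor Y Z) :
  Ciso C s -> f ∘ s = g ∘ s -> qT hA C f = qT hA C g.
Proof.
move=> Cs e; have h (u : Mor Y Z) : srep (qT hA C u) s (u ∘ s).
  rewrite -{1}(hcomp1m s); apply: srep_refine; first exact: srep_T.
  by rewrite hcomp1m.
by apply: srep_uniq (h f) _; rewrite e; apply: h.
Qed.

End SerreSubcategories.

(** * Two-sided Serre tensor-ideals *)

Section Ideal.
Variables (K : fieldType) (A : multiringCat K) (A_dual : has_left_duals A).
Variables (I : finType) (one : I -> A).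
Variables (inj : forall i, Mor (one i) (munit A)).
Variables (prj : forall i, Mor (munit A) (one i)).
Hypothesis A_unit : unit_decomposition inj prj.
Variable C : tensorIdeal A.
Let hA := mr_abelian A.
Let bip : is_biproduct inj prj. Proof. by case: A_unit. Qed.
Local Notation p i := (inj i ∘ prj i).
Local Notation T := (quotient_functor C).

(** The identity of [X] factors through [coev ⊠ X], and [coev ∘ inj i] is zero
    as a morphism from a simple object outside [C] to [X ⊗ X'] in [C]. *)
Lemma ideal_lact0 X i : C X -> ~ C (one i) -> lact (p i) X = 0.
Proof.
move=> CX nCi; have [X' [ev [coev [zig _]]]] := A_dual X.
have h : coev ∘ inj i = 0.
  apply: (@simple_serre_out _ _ hA C) nCi.
    exact: unit_summand_simple A_unit.
  exact: ti_tensr.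
rewrite -[LHS]hcomp1m -zig -lin_lout.
rewrite -(hcompA _ (coev ⊠ _)) -/(lout coev X) -hcompA (hcompA (lout coev X)).
by rewrite lout_lin h tensm0l hcomp0m hcompm0.
Qed.

(** The identity of [X] factors through [X ⊠ ev], and [prj i ∘ ev] is zero as a
    morphism from [X' ⊗ X] in [C] to a simple object outside [C]. *)
Lemma ideal_ract0 X i : C X -> ~ C (one i) -> ract (p i) X = 0.
Proof.
move=> CX nCi; have [X' [ev [coev [zig _]]]] := A_dual X.
have h : prj i ∘ ev = 0.
  apply: (@simple_serre_in _ _ hA C) nCi.
    exact: unit_summand_simple A_unit.
  exact: ti_tensl.
have zig' : rin ev X ∘ (massoc X X' X ∘ (coev ⊠ idm X) ∘ ibwd (mlunit X)) =
    idm X by rewrite !hcompA.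
rewrite -[LHS]hcompm1 -zig' -rin_rout -(hcompA (rin (inj i) X)).
by rewrite (hcompA (rout _ X)) rout_rin h tensm0r hcomp0m hcompm0.
Qed.

Let J : {set I} := [set i | `[< C (one i) >]].
Local Notation e := (unit_part inj prj (fun i => i \notin J)).
Local Notation e' := (unit_part inj prj (fun i => i \in J)).

Lemma unit_idealP i : reflect (C (one i)) (i \in J).
Proof. by rewrite inE; apply: asboolP. Qed.

Lemma ideal_lact_part0 X : C X -> lact e X = 0.
Proof.
move=> CX; rewrite lact_sum big1 // => i /unit_idealP; exact: ideal_lact0.
Qed.

Lemma ideal_ract_part0 X : C X -> ract e X = 0.
Proof.
move=> CX; rewrite ract_sum big1 // => i /unit_idealP; exact: ideal_ract0.
Qed.

Lemma lact_partE X : lact e X + lact e' X = idm X.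
Proof. by rewrite -lactD addrC unit_partC // lact1. Qed.

Lemma ract_partE X : ract e X + ract e' X = idm X.
Proof. by rewrite -ractD addrC unit_partC // ract1. Qed.

Lemma ideal_sum_components X : C X <->
  sum_subcat (fun q : {i | i \in J} * {i | i \in J} =>
    component one (val q.1) (val q.2)) X.
Proof.
split=> [CX|[Y [iq [pq [Yc b]]]]].
  apply/(sum_component_act bip); split.
    by rewrite -[RHS]lact_partE ideal_lact_part0 // add0r.
  by rewrite -[RHS]ract_partE ideal_ract_part0 // add0r.
apply: serre_sum b _ => q; have [Z YZ] := Yc q.
by apply: serre_iso YZ _; apply/ti_tensl/unit_idealP/(valP q.2).
Qed.

(** The mixed terms [lact e ∘ ract e'] and [lact e' ∘ ract e] vanish: if [i ∈ J]
    then [X ⊗ 1_i] and [1_i ⊗ X] are in [C], where [e] acts as zero. *)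
Lemma lact_ract_part X : lact e X = ract e X.
Proof.
have le : lact e X ∘ ract e' X = 0.
  rewrite ract_sum hcomp_sumr big1 // => i /unit_idealP Ci.
  rewrite -rin_rout hcompA lact_nat ideal_lact_part0 ?hcompm0 ?hcomp0m //.
  exact: ti_tensl.
have el : lact e' X ∘ ract e X = 0.
  rewrite lact_sum hcomp_suml big1 // => i /unit_idealP Ci.
  rewrite -lin_lout -hcompA -ract_nat ideal_ract_part0 ?hcomp0m ?hcompm0 //.
  exact: ti_tensr.
rewrite -(hcompm1 (lact e X)) -(ract_partE X) hcompDr le addr0.
by rewrite -[RHS]hcomp1m -(lact_partE X) hcompDl el addr0.
Qed.

Lemma ideal_lact X : C X <-> lact e X = 0.
Proof.
split=> [|e0]; first exact: ideal_lact_part0.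
apply/ideal_sum_components/(sum_component_act bip); split.
  by rewrite -[RHS]lact_partE e0 add0r.
by rewrite -[RHS]ract_partE -lact_ract_part e0 add0r.
Qed.

Local Notation D := (sum_subcat (fun q : {i | i \notin J} * {i | i \notin J} =>
    component one (val q.1) (val q.2))).

Lemma complement_lact X : D X <-> lact e X = idm X.
Proof.
split=> [/(sum_component_act bip)[]//|eX].
by apply/(sum_component_act bip); rewrite -lact_ract_part.
Qed.

Lemma complement_tens X Y : D X -> D (X ⊗ Y).
Proof.
move=> /complement_lact DX; apply/complement_lact.
by rewrite lact_tens DX tensm_id.
Qed.

Lemma component_complement i j X :
  i \notin J -> component one i j X -> D X.
Proof.
move=> ni /(component_act bip) [eX _]; apply/complement_lact.
by rewrite -[LHS]hcompm1 -eX -lact_comp unit_part_idem // ni.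
Qed.

Lemma complement_ideal_hom X Y (f : Mor X Y) : D X -> C Y -> f = 0.
Proof.
move=> /complement_lact eX /ideal_lact eY.
by rewrite -(hcompm1 f) -eX -lact_nat eY hcomp0m.
Qed.

Lemma ideal_complement_hom X Y (f : Mor X Y) : C X -> D Y -> f = 0.
Proof.
move=> /ideal_lact eX /complement_lact eY.
by rewrite -(hcomp1m f) -eY lact_nat eX hcompm0.
Qed.

(** The kernel of [s] is an object of [C] mapping to [X], and the cokernel an
    object of [C] receiving [Y]; both morphisms are zero. *)
Lemma Ciso_complement_iso X Y (s : Mor X Y) :
  D X -> D Y -> Ciso C s -> is_iso s.
Proof.
move=> DX DY [Ks Cs]; apply: mono_epi_iso => //.
  apply: monoP => W g sg; have [N [k hk]] := ab_kernel hA s.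
  have [h <-] := kernel_fac hk sg.
  rewrite (ideal_complement_hom k _ DX) ?hcomp0m //.
  by apply: Ks (kernel_mono hk) _; case: hk.
apply: epiP => W g gs; have [N [k hk]] := ab_cokernel hA s.
have [h <-] := cokernel_fac hk gs.
rewrite (complement_ideal_hom k DY) ?hcompm0 //.
by apply: Cs (cokernel_epi hk) _; case: hk.
Qed.

(** If [T f = 0], then [f] vanishes on some [w] whose cokernel is in [C], so it
    factors through that cokernel, to which [X] has only the zero morphism. *)
Lemma T_complement_faithful X Y (f : Mor X Y) : D X -> fmap T f = 0 -> f = 0.
Proof.
move=> DX; rewrite -(fmap0 T X Y) => Tf.
have hf := srep_T hA C f; have := srep_T hA C (0 : Mor X Y).
rewrite -[qT _ _ 0]Tf => h0.
have [P [w [w' [Cw _ fw]]]] := srep_common hf h0.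
rewrite hcomp1m in Cw; rewrite hcomp0m in fw.
have [Q [c hc]] := ab_cokernel hA w; have [h <-] := cokernel_fac hc fw.
rewrite (complement_ideal_hom c DX) ?hcompm0 //.
by apply: (proj2 Cw) (cokernel_epi hc) _; case: hc.
Qed.

(** * The quotient functor on the complement of the ideal *)

Section Summand.
(** [U] is the image of the idempotent [e], that is [⊕_(i ∉ J) 1_i]. *)
Variables (U : A) (u : Mor U (munit A)) (v : Mor (munit A) U).
Hypotheses (vu : v ∘ u = idm U) (uv : u ∘ v = e).

Lemma complement_summand X : D (U ⊗ X).
Proof. by apply/complement_lact; rewrite -uv lact_summand. Qed.

(** [U] is isomorphic to [U ⊗ 1]. *)
Lemma complement_unit : D U.
Proof.
apply/complement_lact; apply: (lact_iso (Y := U ⊗ munit A)).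
  by exists (ibwd (mrunit U)); apply: ibwd_is_iso.
by rewrite -uv lact_summand.
Qed.

Lemma complement_lin_iso X : D X -> is_iso (lin u X).
Proof.
move=> /complement_lact eX; exists (lout v X).
by rewrite lin_lout lout_lin vu uv tensm_id.
Qed.

Lemma complement_rin_iso X : D X -> is_iso (rin u X).
Proof.
move=> /complement_lact eX; exists (rout v X).
by rewrite rin_rout rout_rin vu uv tensm_id -lact_ract_part.
Qed.

Lemma complement_sub_unital : sub_unital D u.
Proof.
split; first exact: complement_unit.
- by move=> X Y DX _; apply: complement_tens.
- exact: complement_lin_iso.
exact: complement_rin_iso.
Qed.

(** [lin u X] is split mono, and a quotient of [X] that kills it is killed by
    [e]. *)
Lemma lin_Ciso X : Ciso C (lin u X).
Proof.
split; first exact/mono_smallK/(lin_mono vu).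
move=> W h eh hu; apply/ideal_lact; apply: (epi0 eh).
by rewrite lact_nat -uv -lin_lout hcompA hu hcomp0m.
Qed.

Lemma T_lact_part X : fmap T (lact e X) = idm (T X).
Proof.
rewrite -fmap_id; change (qT hA C (lact e X) = qT hA C (idm X)).
apply: (Ciso_T_eq hA (lin_Ciso X)).
by rewrite -uv -lin_lout -hcompA lout_lin vu tensm_id hcompm1 hcomp1m.
Qed.

Lemma T_unit_part : fmap T e = idm (T (munit A)).
Proof. by rewrite -(lact_unit e) T_lact_part. Qed.

Lemma T_lin_iso X : is_iso (fmap T (lin u X)).
Proof.
exists (fmap T (lout v X)); rewrite -!fmap_comp lin_lout lout_lin vu uv.
by rewrite tensm_id fmap_id T_lact_part.
Qed.

(** Given a fraction [X ← Q → Y], replacing [Q] by [U ⊗ Q ∈ D] makes its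
    denominator a morphism between objects of [D], which is invertible. *)
Lemma T_complement_full X Y (g : Mor (T X) (T Y)) : D X ->
  exists f, fmap T f = g.
Proof.
move=> DX; have [Q [s [t h]]] := srep_ex g.
have Cs : Ciso C (s ∘ lin u Q).
  exact: Ciso_comp (srep_Ciso h) (lin_Ciso Q).
have [r [rs sr]] := Ciso_complement_iso (complement_summand Q) DX Cs.
exists (t ∘ lin u Q ∘ r); apply: srep_uniq (srep_refine h Cs).
have := @srep_refine _ _ hA C _ _ _ _ _ _ _ (s ∘ lin u Q)
  (srep_T hA C (t ∘ lin u Q ∘ r)).
by rewrite hcomp1m -(hcompA (t ∘ lin u Q)) rs hcompm1; apply.
Qed.

Lemma T_complement_equivalence : is_equivalence (restrict T D).
Proof.
apply: is_equivalence_ff => [X Y f|X Y g|Y].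
- exact: T_complement_faithful (svalP X).
- exact: T_complement_full (svalP X).
exists (exist D (U ⊗ Y) (complement_summand Y)).
exists (fmap T (lin u Y)); exact: T_lin_iso.
Qed.

Lemma T_complement_monoidal :
  @is_monoidal K (sub_mon complement_sub_unital) (quotient_mon C)
    (restrict T D) (fun X Y => idm _) (fmap T v).
Proof.
split.
- split; first by move=> X Y; apply: is_iso_id.
  exists (fmap T u); rewrite -!(fmap_comp T) uv vu T_unit_part.
  by rewrite (fmap_id T).
- move=> X X' Y Y' f g /=.
  by rewrite [LHS]qcomp1m [RHS]qcompm1; apply: qtens_T.
- move=> [X DX] [Y DY] [Z DZ].
  change (qcomp (qcomp (qT hA C (massoc X Y Z)) (qT hA C (idm (X ⊗ Y ⊗ Z))))
      (qtens (qT hA C (idm (X ⊗ Y))) (qT hA C (idm Z))) =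
    qcomp (qcomp (qT hA C (idm (X ⊗ (Y ⊗ Z))))
      (qtens (qT hA C (idm X)) (qT hA C (idm (Y ⊗ Z)))))
      (qT hA C (massoc X Y Z))).
  by rewrite !qtens_T -!qT_comp !tensm_id !hcompm1 !hcomp1m.
- move=> [X DX]; have eX := (complement_lact X).1 DX.
  change (qcomp (qcomp (qT hA C (lin u X)) (qT hA C (idm (U ⊗ X))))
    (qtens (qT hA C v) (qT hA C (idm X))) = qT hA C (mlunit X)).
  rewrite qtens_T -!qT_comp hcompm1; congr (qT hA C _).
  rewrite /lin -hcompA -tensm_comp hcompm1 uv -/(lin _ X) -lact_lunit.
  by rewrite eX hcomp1m.
move=> [X DX]; have eX := (complement_lact X).1 DX.
change (qcomp (qcomp (qT hA C (rin u X)) (qT hA C (idm (X ⊗ U))))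
  (qtens (qT hA C (idm X)) (qT hA C v)) = qT hA C (mrunit X)).
rewrite qtens_T -!qT_comp hcompm1; congr (qT hA C _).
rewrite /rin -hcompA -tensm_comp hcompm1 uv -/(rin _ X) -ract_runit.
by rewrite -lact_ract_part eX hcomp1m.
Qed.

(** The equation [e ∘ f = f] says that [f] lies in the corner of [End(1)] cut
    out by the central idempotent [e]. *)
Lemma T_unit_full (g : Mor (T (munit A)) (T (munit A))) :
  exists f, e ∘ f = f /\ fmap T f = g.
Proof.
have [h Th] := T_complement_full (g ∘ fmap T u) complement_unit.
have eU := (complement_lact U).1 complement_unit.
exists (h ∘ v); split.
  by rewrite hcompA -{1}(lact_unit e) lact_nat eU hcompm1.
by rewrite fmap_comp Th -hcompA -fmap_comp uv T_unit_part hcompm1.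
Qed.

Lemma T_unit_faithful (f : Mor (munit A) (munit A)) :
  e ∘ f = f -> fmap T f = 0 -> f = 0.
Proof.
move=> ef Tf; have fe : f ∘ e = f.
  by rewrite -{2}ef -(lact_unit e) lact_nat.
have fu0 : f ∘ u = 0.
  apply: (T_complement_faithful complement_unit).
  by rewrite fmap_comp Tf hcomp0m.
by rewrite -fe -uv hcompA fu0 hcomp0m.
Qed.

Lemma T_unit_inj (f g : Mor (munit A) (munit A)) :
  e ∘ f = f -> e ∘ g = g -> fmap T f = fmap T g -> f = g.
Proof.
move=> ef eg Tfg; apply/subr0_eq/T_unit_faithful.
  by rewrite hcompBr ef eg.
by rewrite fmapB Tfg subrr.
Qed.

(** [T] maps the corner of [e] isomorphically onto the endomorphisms of the
    unit of the quotient, and the summands of an idempotent of the corner are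
    again in the corner. *)
Lemma T_primitive_idempotent (f : Mor (munit A) (munit A)) : e ∘ f = f ->
  primitive_idempotent f <->
  @primitive_idempotent K (quotient_mon C) (munit A) (fmap T f).
Proof.
move=> ef; split=> [[f0 ff fmin]|[f0 ff fmin]].
  split=> [Tf|| g1 g2].
  - by apply: f0; apply: T_unit_faithful.
  - by rewrite -(fmap_comp T) ff.
  have [f1 [ef1 <-]] := T_unit_full g1; have [f2 [ef2 <-]] := T_unit_full g2.
  rewrite -!(fmap_comp T) -(fmapD T) -(fmap0 T) => h11 h22 h12 h21 hf.
  have eM (a b : Mor (munit A) (munit A)) : e ∘ a = a -> e ∘ (a ∘ b) = a ∘ b.
    by move=> ea; rewrite hcompA ea.
  have [|||||-> | ->] := fmin f1 f2.
  - by apply: T_unit_inj h11; rewrite ?eM.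
  - by apply: T_unit_inj h22; rewrite ?eM.
  - by apply: T_unit_inj h12; rewrite ?eM ?hcompm0.
  - by apply: T_unit_inj h21; rewrite ?eM ?hcompm0.
  - by apply: T_unit_inj hf; rewrite ?hcompDr ?ef1 ?ef2.
  - by left.
  by right.
split=> [fz||f1 f2 h11 h22 h12 h21 hf].
- by apply: f0; rewrite fz (fmap0 T).
- by apply: T_unit_inj; rewrite ?hcompA ?ef ?fmap_comp.
have ef1 : e ∘ f1 = f1.
  have <- : f ∘ f1 = f1 by rewrite hf hcompDl h11 h21 addr0.
  by rewrite hcompA ef.
have ef2 : e ∘ f2 = f2.
  have <- : f ∘ f2 = f2 by rewrite hf hcompDl h12 h22 add0r.
  by rewrite hcompA ef.
have [|||||T1|T2] := fmin (fmap T f1) (fmap T f2).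
- by rewrite -(fmap_comp T) h11.
- by rewrite -(fmap_comp T) h22.
- by rewrite -(fmap_comp T) h12 (fmap0 T).
- by rewrite -(fmap_comp T) h21 (fmap0 T).
- by rewrite hf (fmapD T).
- by left; apply: T_unit_faithful.
by right; apply: T_unit_faithful.
Qed.

(** The [p i] in the corner of [e] are those with [i ∉ J]. *)
Lemma T_unit_decomposition :
  @unit_decomposition K (quotient_mon C) {i | i \notin J}
    (fun i => T (one (val i)))
    (fun i => fmap T (inj (val i))) (fun i => fmap T (prj (val i))).
Proof.
have [_ pinj prim] := A_unit.
have ep (i : {i | i \notin J}) : e ∘ p (val i) = p (val i).
  by rewrite unit_part_idem // (valP i).
split.
- split=> [i|i j ij|].
  + by rewrite -(fmap_comp T) prj_inj // (fmap_id T).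
  + by rewrite -(fmap_comp T) prj_inj_neq ?(fmap0 T).
  transitivity (fmap T e); last exact: T_unit_part.
  rewrite fmap_sum.
  rewrite -(sum_sig (fun i => i \notin J) (fun i => fmap T (p i))).
  by apply: eq_bigr => i _; rewrite -(fmap_comp T).
- move=> i j; cbv beta; rewrite -!(fmap_comp T) => Tij.
  by apply/val_inj/pinj; apply: T_unit_inj Tij.
move=> g; split=> [|[i ->]].
  have [f [ef <-]] := T_unit_full g.
  move=> /(T_primitive_idempotent ef) pf; have [i fi] := (prim f).1 pf.
  have [f0 _ _] := pf.
  have ni : i \notin J.
    by apply/negP => iJ; apply: f0; rewrite -ef fi unit_part_idem // iJ.
  by exists (exist _ i ni); rewrite -(fmap_comp T) fi.
rewrite -(fmap_comp T); apply/(T_primitive_idempotent (ep i)).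
by apply/prim; exists (val i).
Qed.

End Summand.

(** * Components of the quotient *)

Section Components.
Variables (U : A) (u : Mor U (munit A)) (v : Mor (munit A) U).
Hypotheses (vu : v ∘ u = idm U) (uv : u ∘ v = e).
Variables i j : {i | i \notin J}.

Lemma T_component X : component one (val i) (val j) X ->
  @component K (quotient_mon C) {i | i \notin J} (fun l => T (one (val l))) i j
    (T X).
Proof.
by move=> [Y [f fi]]; exists Y, (fmap T f); apply: (fmap_is_iso T).
Qed.

Lemma T_component_equivalence : is_equivalence (birestrict T_component).
Proof.
have cD X : component one (val i) (val j) X -> D X.
  exact: component_complement (valP i).
apply: is_equivalence_ff => [X Y f|X Y g|[Y [Z YZ]]].
- exact: T_complement_faithful (cD _ (svalP X)).
- exact: (T_complement_full vu uv) (cD _ (svalP X)).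
have c : component one (val i) (val j) (one (val i) ⊗ Z ⊗ one (val j)).
  by exists Z, (idm _); apply: is_iso_id.
by exists (exist _ _ c); apply: isomorphic_sym.
Qed.

End Components.
End Ideal.

(** * The quotient by a two-sided Serre tensor-ideal *)

Theorem mainTheorem8 (K : closedFieldType) (A : multiringCat K)
    (A_dual : has_left_duals A)
    (I : finType) (one : I -> A)
    (inj : forall i, Mor (one i) (munit A))
    (prj : forall i, Mor (munit A) (one i))
    (A_unit : unit_decomposition inj prj)
    (C : tensorIdeal A) :
  let J : {set I} := [set i | `[< C (one i) >]] in
  let notJ : finType := {i : I | i \notin J} in
  let T := quotient_functor C in
  let C' := sum_subcat (fun p : {i : I | i \in J} * {i : I | i \in J} =>
              component one (val p.1) (val p.2)) in
  let D := sum_subcat (fun p : notJ * notJ =>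
              component one (val p.1) (val p.2)) in
  [/\ (* C = ⊕_(i, j ∈ J) A_ij *)
      forall X : A, C X <-> C' X,
      (* T restricted to D = ⊕_(i, j ∉ J) A_ij, with unit object
         U = ⊕_(i ∉ J) 1_i, is an equivalence and a monoidal functor *)
      forall (U : A) (injU : forall i : notJ, Mor (one (val i)) U)
          (prjU : forall i : notJ, Mor U (one (val i))),
        is_biproduct injU prjU ->
        exists D_unital : sub_unital D (\sum_i inj (val i) ∘ prjU i),
          let TD : linFunctor (sub_mon D_unital) (quotient_mon C) :=
            restrict T D in
          is_equivalence TD /\
          @is_monoidal K (sub_mon D_unital) (quotient_mon C) TD
            (fun X Y => idm (TD X ⊗ TD Y))
            (fmap T (\sum_i injU i ∘ prj (val i))),
      equivalent (quotient_mon C) (full_subcat D),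
      (* 1_(A/C) = T 1_A = ⊕_(i ∉ J) 1_i *)
      munit (quotient_mon C) = T (munit A) /\
      @unit_decomposition K (quotient_mon C) notJ (fun i => T (one (val i)))
        (fun i => fmap T (inj (val i))) (fun i => fmap T (prj (val i)))
    & (* A_ij is the component (A/C)_ij *)
      forall i j : notJ,
        exists T_ij : forall X, component one (val i) (val j) X ->
            @component K (quotient_mon C) notJ (fun l => T (one (val l))) i j
              (T X),
          is_equivalence (birestrict T_ij)].
Proof.
have bip : is_biproduct inj prj by case: A_unit.
move=> J notJ T C' D.
have summand (U : A) (injU : forall i : notJ, Mor (one (val i)) U)
    (prjU : forall i : notJ, Mor U (one (val i))) :
    is_biproduct injU prjU ->
    (\sum_i injU i ∘ prj (val i)) ∘ (\sum_i inj (val i) ∘ prjU i) = idm U /\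
    (\sum_i inj (val i) ∘ prjU i) ∘ (\sum_i injU i ∘ prj (val i)) =
      unit_part inj prj (fun i => i \notin J).
  exact: unit_part_summand.
have [U [injU [prjU bU]]] :=
  ab_biproduct (mr_abelian A) (fun i : notJ => one (val i)).
have [vu uv] := summand _ _ _ bU.
split.
- by move=> X; apply: (ideal_sum_components A_dual A_unit).
- move=> V injV prjV /summand [vu' uv'].
  exists (complement_sub_unital A_dual A_unit vu' uv'); split.
    exact: (T_complement_equivalence A_dual A_unit vu' uv').
  exact: T_complement_monoidal.
- apply: is_equivalence_equivalent.
  exact: (T_complement_equivalence A_dual A_unit vu uv).
- by split=> //; apply: (T_unit_decomposition A_dual A_unit vu uv).
move=> i j; exists (@T_component _ _ _ _ _ i j).
exact: (T_component_equivalence A_dual A_unit vu uv).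
Qed.
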